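(* (i) The integral defining $d_n$ converges absolutely for all $n\ge0$. (ii) $d_{2n+1}=0$ for all $n\ge0$. (iii) $d_{2n}>0$ for all $n\ge0$. (iv) For all $n\ge0$, $d_n$ can be expressed alternatively in terms of the coefficients $c_k$ as $$d_n=\frac{n+1}{2^n}\sum_{m=0}^\infty\frac{(3/2)_{n+2m}}{4^m\,m!\,(n+m+1)!}\,c_{n+2m}.$$
   Context: For $x>0$ let $\omega(x)=\sum_{m=1}^\infty(2\pi^2m^4x^2-3\pi m^2x)e^{-\pi m^2x}$. For $n\ge0$ define $$c_n=2\sqrt2\int_0^\infty\frac{\omega(x)}{(x+1)^{3/2}}\left(\frac{x-1}{x+1}\right)^n\,dx$$ and $$d_n=\frac{(3/2)_n}{2^{n-3/2}\,n!}\int_0^\infty\frac{\omega(x)}{(x+1)^{3/2}}\left(\frac{x-1}{x+1}\right)^n{}_2F_1\left(\frac n2+\frac34,\frac n2+\frac54;n+2;\left(\frac{x-1}{x+1}\right)^2\right)dx .$$ Here $(a)_n=a(a+1)\cdots(a+n-1)$ is the Pochhammer symbol and ${}_2F_1$ is the Gauss hypergeometric function. *)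

(* Defs.v *)
From HB Require Import structures.
From mathcomp Require Import all_boot all_order all_algebra.
From mathcomp Require Import all_classical all_reals all_analysis.

Set Implicit Arguments.
Unset Strict Implicit.
Unset Printing Implicit Defensive.

Import Order.TTheory GRing.Theory Num.Theory.
Import numFieldNormedType.Exports.

Local Open Scope classical_set_scope.
Local Open Scope ring_scope.

Section defs.
Variable R : realType.

Definition omega (x : R) : R :=
  limn (fun N : nat => \sum_(1 <= m < N)
    (2 * pi ^+ 2 * m%:R ^+ 4 * x ^+ 2 - 3 * pi * m%:R ^+ 2 * x)
      * expR (- (pi * m%:R ^+ 2 * x))).

Definition pochhammer (a : R) (n : nat) : R := \prod_(i < n) (a + i%:R).

(* The Gauss series; it defines 2F1(a, b; c; z) only for `|z| < 1 and c not a
   nonpositive integer. Below, z = ((x - 1) / (x + 1)) ^+ 2 with x > 0, so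
   0 <= z < 1, and c = n + 2. *)
Definition hyp2F1 (a b c z : R) : R :=
  limn (fun N : nat => \sum_(0 <= k < N)
    pochhammer a k * pochhammer b k / (pochhammer c k * k`!%:R) * z ^+ k).

Definition c_integrand (n : nat) (x : R) : R :=
  omega x / (x + 1) `^ (3 / 2) * ((x - 1) / (x + 1)) ^+ n.

Definition c_coef (n : nat) : R :=
  2 * Num.sqrt 2 *
  \int[@lebesgue_measure R]_(x in `]0, +oo[) c_integrand n x.

Definition d_integrand (n : nat) (x : R) : R :=
  omega x / (x + 1) `^ (3 / 2) * ((x - 1) / (x + 1)) ^+ n
  * hyp2F1 (n%:R / 2 + 3 / 4) (n%:R / 2 + 5 / 4) (n%:R + 2)
      (((x - 1) / (x + 1)) ^+ 2).

Definition d_coef (n : nat) : R :=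
  pochhammer (3 / 2) n / (2 `^ (n%:R - 3 / 2) * n`!%:R) *
  \int[@lebesgue_measure R]_(x in `]0, +oo[) d_integrand n x.

End defs.

(* Main.v *)
Require Import Defs.
From mathcomp Require Import all_boot all_order all_algebra.
From mathcomp Require Import all_classical all_reals all_analysis.
From mathcomp Require Import measurable_realfun.
From mathcomp Require Import ring lra zify.

(** Everything rests on the functional equation [omega y^-1 = sqrt y * omega y].
Together with the exponential decay of [omega] at infinity and the positivity
of its terms on [[1, +oo[], which are visible on the series, it yields that
[omega] is positive on the whole half line and decays at [0] as well.

The functional equation is the theta inversion formula in disguise.  It is
proved in the manner of Polya, as a limit of an identity between finite sums.
Put [p N k = 'C(2N, N+k) / 4^N], the Fourier coefficients of [cos^(2N)].  For
odd [l = 2h+1], summing [cos^(2N)] over the angles [pi j / l] keeps only the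
frequencies divisible by [l] ([discrete_theta]):
  [-1 + 2 sum_(0 <= j <= h) cos (pi j / l)^(2N)
     = l (- p N 0 + 2 sum_(j >= 0) p N (j l))].
As [l] grows with [N] of order [l^2 x], the left side tends to a theta series
at [x] and the right side to one at [1/x].  Since [omega] is the image of theta
under [2 x^2 (d/dx)^2 + 3 x (d/dx)], it is enough to combine the identity for
three successive values of [N] with the weights of a discrete version of this
operator ([discrete_omega]); no series is ever differentiated.  The weights
annihilate both the constant [-1] and the term [p N 0], so that the two sides
become sums of [theta_cos] and [theta_bin], which converge term by term, under
a summable bound, to the terms of [omega] ([tannery], [omega_scaling_limit]).
The limit identity carries the constant [c0 = lim N (p N 0)^2].  Its value
[1 / pi] need not be known from Wallis' formula: taking [y = 1] in the limit
identity gives [omega 1 = sqrt (c0 pi) * omega 1], and [omega 1 > 0].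

Write [z = ((x-1)/(x+1))^2].  In the series 2F1(a, b; c; z) of [d_n] one has
[a + b = c], so its coefficients are bounded, and the partial sums are at most
a constant times [1 / (1 - z) = (x+1)^2 / (4x)].  This has only a simple pole
at [0] and linear growth at infinity, which the decay of [omega] absorbs: the
integrand is dominated by a multiple of [exp (-x)] ([omega_weight_le]).
Dominated convergence gives the integrability and allows integration term by
term ([d_series]); with the duplication formula for Pochhammer symbols this is
the expansion of [d_n] in the [c_(n+2m)] ([d_coef_series]).

For odd [n] the substitution [x -> 1/x] and the functional equation change the
sign of the integral [c_n] ([odd_moment]), so every term of the expansion of
[d_n] vanishes.  For even [n] the integrand of [d_n] is at least that of [c_n],
which is nonnegative, and positive for [x > 1]. *)

Set Implicit Arguments.
Unset Strict Implicit.
Unset Printing Implicit Defensive.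

Import Order.TTheory GRing.Theory Num.Theory.
Import numFieldNormedType.Exports.

Local Open Scope classical_set_scope.
Local Open Scope ring_scope.

(** * Dominated convergence for series *)

Section DominatedSeries.
Context {R : realType}.
Implicit Types (u M : nat -> R).

Lemma cvgn_series_dominated u M :
  (forall k, `|u k| <= M k) -> cvgn (series M) -> cvgn (series u).
Proof.
move=> uM cM; apply: normed_cvg; apply: (series_le_cvg _ _ _ cM) => k //=.
exact: (le_trans (normr_ge0 (u k)) (uM k)).
Qed.

Lemma series_tail_le u M K : (forall k, `|u k| <= M k) -> cvgn (series M) ->
  `|limn (series u) - series u K| <= limn (series M) - series M K.
Proof.
move=> uM cM; have cu := cvgn_series_dominated uM cM.
have c1 : `|series u n - series u K| @[n --> \oo] --> `|limn (series u) - series u K|.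
  by apply: cvg_norm; apply: cvgB => //; exact: cvg_cst.
have c2 : series M n - series M K @[n --> \oo] --> limn (series M) - series M K.
  by apply: cvgB => //; exact: cvg_cst.
rewrite -(cvg_lim _ c1)// -(cvg_lim _ c2)//.
apply: ler_lim; [exact: cvgP c1|exact: cvgP c2|].
near=> n; have Kn : (K <= n)%N by near: n; exact: nbhs_infty_ge.
rewrite !sub_series_geq// (le_trans (ler_norm_sum _ _ _))//.
by apply: ler_sum => k _; exact: uM.
Unshelve. all: end_near. Qed.

(** Cut both series at an index [K] beyond which the dominating series is
small, uniformly in [n]; the finite sums that remain converge. *)
Lemma tannery (f : nat -> nat -> R) (g M : nat -> R) :
  (\forall n \near \oo, forall k, `|f n k| <= M k) -> cvgn (series M) ->
  (forall k, f n k @[n --> \oo] --> g k) ->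
  limn (series (f n)) @[n --> \oo] --> limn (series g).
Proof.
move=> fM cM fg.
have gM k : `|g k| <= M k.
  have c : `|f n k| @[n --> \oo] --> `|g k| by apply: cvg_norm.
  rewrite -(cvg_lim _ c)//; apply: limr_le; first exact: cvgP c.
  by near=> n; have /(_ k) : forall k, `|f n k| <= M k by near: n.
apply/cvgrPdist_le => e e0.
have e3 : 0 < e / 3 by rewrite divr_gt0.
have /cvgrPdist_le/(_ _ e3)[K _ HK] := cM.
have {HK} := HK K (leqnn _) => /= HK.
have cK : series (f n) K @[n --> \oo] --> series g K.
  elim: K {HK} => [|K IH].
    rewrite /series/= big_geq//.
    by under eq_fun do rewrite big_geq//; exact: cvg_cst.
  rewrite seriesSr; under eq_fun do rewrite seriesSr.
  exact: cvgD.
have /cvgrPdist_le/(_ _ e3) HKf := cK.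
near=> n.
have Hn : forall k, `|f n k| <= M k by near: n.
have H1 := series_tail_le K Hn cM.
have H2 := series_tail_le K gM cM.
have H3 : `|series g K - series (f n) K| <= e / 3 by near: n.
have := le_trans H1 (le_trans (ler_norm _) HK).
have := le_trans H2 (le_trans (ler_norm _) HK).
rewrite !ler_norml in H3 *; lra.
Unshelve. all: end_near. Qed.

Lemma limn_series_finite u N : (forall k, (N <= k)%N -> u k = 0) ->
  limn (series u) = series u N.
Proof.
move=> u0; apply: lim_near_cst => //; near=> n.
have Nn : (N <= n)%N by near: n; exact: nbhs_infty_ge.
apply/eqP; rewrite -subr_eq0 sub_series_geq//.
by rewrite big_nat big1// => i /andP[Ni _]; exact: u0.
Unshelve. all: end_near. Qed.

Lemma cvgn_series_expR (a c : R) : 0 < c ->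
  cvgn (series (fun k => a * expR (- (c * k%:R)))).
Proof.
move=> c0; rewrite (_ : (fun _ => _) = geometric a (expR (- c))).
  by apply: is_cvg_geometric_series; rewrite ger0_norm ?expR_ge0// expR_lt1 oppr_lt0.
by apply/funext => k /=; rewrite -expRM_natr mulNr.
Qed.

Lemma expR_ge_sqr (y : R) : 0 <= y -> y ^+ 2 <= 2 * expR y.
Proof.
move=> y0; have := @expR_ge1Dxn R y 1 y0; rewrite !factS fact0 !muln1; lra.
Qed.

(** Half of the exponent pays for the polynomial factor. *)
Lemma poly_expR_le (y : R) : 0 <= y ->
  (y ^+ 2 <= 8 * expR (y / 2)) /\ (y <= 2 * expR (y / 2)).
Proof.
move=> y0; have y2 : 0 <= y / 2 by rewrite divr_ge0.
have := expR_ge_sqr y2; have := expR_ge1Dx (y / 2).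
rewrite expr_div_n; split; lra.
Qed.

(** The terms of [omega] and their discrete analogues all have majorants of
this shape. *)
Lemma cvgn_series_gauss (a b c : R) : 0 <= a -> 0 <= b -> 0 < c ->
  cvgn (series (fun k =>
    (a * (k%:R ^+ 2) ^+ 2 + b * k%:R ^+ 2) * expR (- (c * k%:R ^+ 2)))).
Proof.
move=> a0 b0 c0.
apply: series_le_cvg (@cvgn_series_expR (a * (8 / c ^+ 2) + b * (2 / c)) (c / 2) _).
- by move=> k; rewrite mulr_ge0 ?expR_ge0// addr_ge0// mulr_ge0// ?exprn_ge0.
- by move=> k; rewrite mulr_ge0 ?expR_ge0// addr_ge0// mulr_ge0// divr_ge0// ?exprn_ge0// ltW.
- move=> k; set q : R := k%:R ^+ 2.
  have q0 : 0 <= q by rewrite exprn_ge0.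
  have kq : k%:R <= q.
    by rewrite /q -natrX ler_nat; case: k {q q0} => // k; rewrite expnS expn1 leq_pmulr.
  have [h1 h2] := poly_expR_le (mulr_ge0 (ltW c0) q0).
  have e1 : expR (- (c * q)) = expR (- (c * q / 2)) ^+ 2.
    by rewrite -expRM_natr; congr expR; field.
  have E0 := expR_gt0 (- (c * q / 2)).
  have EE : expR (c * q / 2) * expR (- (c * q / 2)) = 1 by rewrite expRxMexpNx_1.
  have e2 : expR (- (c * q / 2)) <= expR (- (c / 2 * k%:R)).
    by rewrite ler_expR; have := ler_wpM2l (ltW c0) kq; lra.
  apply: le_trans (ler_wpM2l _ e2); last first.
    by rewrite addr_ge0// mulr_ge0// divr_ge0// ?exprn_ge0// ltW.
  rewrite e1 [expR _ ^+ 2]expr2 mulrA ler_wpM2r ?(ltW E0)//.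
  set E := expR (- _) in E0 EE *; set P := expR (_ / 2) in h1 h2 EE.
  have h1' : q ^+ 2 * E <= 8 / c ^+ 2.
    rewrite ler_pdivlMr ?exprn_gt0//.
    have := ler_wpM2r (ltW E0) h1; rewrite -(mulrA 8) EE exprMn; lra.
  have h2' : q * E <= 2 / c.
    rewrite ler_pdivlMr//; have := ler_wpM2r (ltW E0) h2; rewrite -(mulrA 2) EE; lra.
  by rewrite mulrDl -(mulrA a) -(mulrA b) lerD// ler_wpM2l.
- by rewrite divr_gt0.
Qed.

End DominatedSeries.

(** * A finite theta inversion formula *)

Section DiscreteTheta.
Context {R : realType}.
Implicit Types (N n h d k : nat).

(** The product formula turns [2 sin (a/2) cos (j a)] into a difference of
consecutive sines. *)
Lemma sum_cos_telescope (a : R) h :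
  sin (a / 2) * (- 1 + 2 * \sum_(0 <= j < h.+1) cos (j%:R * a)) =
  sin ((h%:R + 1 / 2) * a).
Proof.
elim: h => [|h IH]; first by rewrite big_nat1 mul0r cos0 add0r mulr1 (mulrC (1 / 2)) mulrA mulr1; lra.
rewrite big_nat_recr//= !mulrDr addrA -mulrDr IH.
have -> : (h.+1%:R + 1 / 2) * a = h.+1%:R * a + a / 2 by field.
have -> : (h%:R + 1 / 2) * a = h.+1%:R * a - a / 2 by rewrite -natr1; field.
rewrite sinB sinD; ring.
Qed.

Lemma sin_pi_div_neq0 l r : (0 < r < l)%N -> sin (pi * r%:R / l%:R) != 0 :> R.
Proof.
move=> /andP[r0 rl]; have l0 : (0 : R) < l%:R by rewrite ltr0n (leq_trans _ rl).
apply/lt0r_neq0/sin_gt0_pi; rewrite divr_gt0 ?mulr_gt0 ?pi_gt0 ?ltr0n//=.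
rewrite ltr_pdivrMr// ltr_pM2l ?pi_gt0// ltr_nat//.
by rewrite (leq_trans _ rl).
Qed.

(** The left side is the full sum of [cos (2 pi d j / l)] over the residues
[j] modulo [l]: as [l] is odd, the nonzero residues pair off as [j], [l - j].
So it is [l] or [0] according to whether [l] divides [d]. *)
Lemma dirichlet_kernel_odd h d : let l := h.*2.+1 in
  - 1 + 2 * \sum_(0 <= j < h.+1) cos (2 * d%:R * (pi * j%:R / l%:R)) =
  if (l %| d)%N then l%:R else 0 :> R.
Proof.
move=> l; have l0 : (l%:R : R) != 0 by rewrite pnatr_eq0.
have l2h : (l%:R : R) = 2 * h%:R + 1 by rewrite /l -addn1 natrD -mul2n natrM.
case: ifPn => [/dvdnP[q dq]|ld].
  under eq_bigr => j _.
    have -> : 2 * d%:R * (pi * j%:R / l%:R) = 0 + (pi *+ 2) *+ (q * j) :> R.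
      rewrite add0r -mulrnA -[in RHS]mulr_natr !natrM dq natrM; field.
      by rewrite l2h -l2h.
    rewrite (periodicn (@cosD2pi R)) cos0; over.
  by rewrite big_const_nat subn0 iter_addr addr0 l2h -mulr_natr -natr1; ring.
set a : R := 2 * d%:R * pi / l%:R.
have hsin : sin (a / 2) != 0.
  have -> : a / 2 = pi * (d %% l)%:R / l%:R + pi *+ (d %/ l).
    rewrite /a {1}(divn_eq d l) natrD natrM -[pi *+ _]mulr_natr; field.
    by rewrite l2h -l2h.
  rewrite (alternatingn (@sinDpi R)) mulf_neq0 ?signr_eq0//.
  by apply: sin_pi_div_neq0; rewrite ltn_mod lt0n ld.
apply: (mulfI hsin); rewrite mulr0.
under eq_bigr => j _.
  have -> : 2 * d%:R * (pi * j%:R / l%:R) = j%:R * a by rewrite /a; field; rewrite l2h -l2h.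
  over.
rewrite sum_cos_telescope.
have -> : (h%:R + 1 / 2) * a = 0 + pi *+ d.
  by rewrite add0r -mulr_natr /a l2h; field; rewrite -l2h.
by rewrite (alternatingn (@sinDpi R)) sin0 mulr0.
Qed.

Lemma sum_bin_recr N (F : nat -> R) :
  \sum_(0 <= i < N.+2) 'C(N.+1, i)%:R * F i =
  \sum_(0 <= i < N.+1) 'C(N, i)%:R * (F i + F i.+1).
Proof.
rewrite big_nat_recl//= bin0 mul1r.
under eq_bigr do rewrite binS natrD mulrDl.
under [RHS]eq_bigr do rewrite mulrDr.
rewrite !big_split/= addrA; congr (_ + _).
rewrite big_nat_recr//= bin_small// mul0r addr0.
by rewrite [RHS]big_nat_recl//= bin0 mul1r.
Qed.

(** The real part of the binomial theorem for
[(exp (i theta) + exp (- i theta))^N]; the free phase [phi] makes the induction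
on [N] go through without complex numbers. *)
Lemma sum_bin_cos N (phi theta : R) :
  \sum_(0 <= i < N.+1) 'C(N, i)%:R * cos (phi + (2 * i%:R - N%:R) * theta) =
  (2 * cos theta) ^+ N * cos phi.
Proof.
elim: N phi => [|N IH] phi.
  by rewrite big_nat1 bin0 mul1r expr0 mul1r mulr0 subrr mul0r addr0.
rewrite sum_bin_recr.
under eq_bigr => i _.
  have -> : phi + (2 * i%:R - N.+1%:R) * theta = (phi - theta) + (2 * i%:R - N%:R) * theta.
    by rewrite -(natr1 N); ring.
  have -> : phi + (2 * i.+1%:R - N.+1%:R) * theta = (phi + theta) + (2 * i%:R - N%:R) * theta.
    by rewrite -(natr1 N) -(natr1 i); ring.
  rewrite mulrDr; over.
rewrite big_split/= !IH cosB cosD exprS; ring.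
Qed.

(** Fourier coefficients of [cos^(2N)], and also the law of a simple random
walk after [2N] steps, whence the Gaussian limit used below. *)
Definition binom_weight N k : R := 'C(2 * N, N + k)%:R / 4 ^+ N.

Lemma binom_weight_small N k : (N < k)%N -> binom_weight N k = 0.
Proof. by move=> Nk; rewrite /binom_weight bin_small ?mul0r//; lia. Qed.

Lemma big_nat_widen0 (g : nat -> R) a b : (a <= b)%N ->
  (forall k, (a <= k)%N -> g k = 0) ->
  \sum_(0 <= k < b) g k = \sum_(0 <= k < a) g k.
Proof.
move=> ab g0; rewrite (@big_cat_nat _ _ _ a)//= [X in _ + X]big_nat [X in _ + X]big1 ?addr0//.
by move=> i /andP[ai _]; exact: g0.
Qed.

(** Folding the symmetric binomial expansion counts every frequency twice
except [0], which is the origin of the correcting term. *)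
Lemma cos_expn_fourier N K (theta : R) : (N < K)%N ->
  cos theta ^+ (2 * N) =
  - binom_weight N 0 +
  2 * \sum_(0 <= k < K) binom_weight N k * cos (2 * k%:R * theta).
Proof.
move=> NK; rewrite (@big_nat_widen0 _ N.+1)//; last first.
  by move=> k Nk; rewrite binom_weight_small// mul0r.
have := sum_bin_cos (2 * N) 0 theta; rewrite cos0 mulr1.
set g := fun i : nat => 'C(2 * N, i)%:R * cos (0 + (2 * i%:R - (2 * N)%:R) * theta) : R.
rewrite (_ : \sum_(0 <= i < _) _ = \sum_(0 <= i < (2 * N).+1) g i)//.
have gsym i : (i < N)%N -> g (N - i.+1)%N = g (N + i.+1)%N.
  move=> iN; rewrite /g -bin_sub; last by lia.
  congr (_%:R * _); first by congr 'C(_, _); lia.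
  by rewrite -[RHS]cosN; congr cos; rewrite natrB// natrD natrM; ring.
rewrite (@big_cat_nat _ _ _ N)//=; last by lia.
rewrite big_nat_rev/= add0n big_nat.
under eq_bigr => i /andP[_ iN] do rewrite gsym//.
rewrite -big_nat/= (_ : (2 * N).+1 = N.+1 + N)%N; last by lia.
rewrite -[X in \sum_(X <= _ < _ + _) _]add0n big_addn addnK.
have -> : \sum_(0 <= i < N) g (N + i.+1)%N = \sum_(0 <= i < N.+1) g (i + N)%N - g N.
  rewrite big_nat_recl//= add0n addrC addKr.
  by apply: eq_bigr => i _; rewrite addnC.
rewrite (_ : \sum_(0 <= i < N.+1) g (i + N)%N =
   4 ^+ N * \sum_(0 <= k < N.+1) binom_weight N k * cos (2 * k%:R * theta)); last first.
  rewrite big_distrr/=; apply: eq_bigr => i _.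
  rewrite mulrA /binom_weight mulrCA mulfV ?expf_neq0// mulr1 /g addnC.
  by congr (_ * cos _); rewrite natrD natrM; ring.
rewrite (_ : g N = 4 ^+ N * binom_weight N 0); last first.
  rewrite /binom_weight mulrCA mulfV ?expf_neq0// mulr1 /g addn0 natrM subrr mul0r addr0.
  by rewrite cos0 mulr1.
rewrite exprMn (exprM 2) (_ : 2 ^+ 2 = 4 :> R); last by ring.
have h4 : 4 ^+ N != 0 :> R by rewrite expf_neq0.
by move=> h; apply: (mulfI h4); rewrite -h; ring.
Qed.

Lemma sum_multiples (g : nat -> R) l M : (0 < l)%N ->
  \sum_(0 <= k < M * l) (if (l %| k)%N then g k else 0) =
  \sum_(0 <= j < M) g (j * l)%N.
Proof.
move=> l0; elim: M => [|M IH]; first by rewrite mul0n !big_geq.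
rewrite big_nat_recr//= -IH (@big_cat_nat _ _ _ (M * l)%N)//=; last by lia.
congr (_ + _); rewrite big_ltn; last by rewrite mulSn; lia.
rewrite dvdn_mull// big_nat big1 ?addr0// => i /andP[Mi iM].
case: ifPn => // /dvdnP[q iq]; move: Mi iM; rewrite iq !ltn_pmul2r//.
by move=> ? ?; lia.
Qed.

(** Expand each cosine power in its Fourier series, exchange the sums and let
[dirichlet_kernel_odd] select the frequencies divisible by [l]. *)
Lemma discrete_theta N M h : (N < M)%N -> let l := h.*2.+1 in
  - 1 + 2 * \sum_(0 <= j < h.+1) cos (pi * j%:R / l%:R) ^+ (2 * N) =
  l%:R * (- binom_weight N 0 + 2 * \sum_(0 <= j < M) binom_weight N (j * l)).
Proof.
move=> NM l.
have l2h : (l%:R : R) = 2 * h%:R + 1 by rewrite /l -addn1 natrD -mul2n natrM.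
have NMl : (N < M * l)%N by rewrite (leq_trans NM)// leq_pmulr.
under eq_bigr do rewrite (cos_expn_fourier _ NMl).
rewrite big_split/= big_const_nat subn0 iter_addr addr0 -big_distrr/= exchange_big/=.
(* The angle 0 gives the total mass of the weights. *)
have := cos_expn_fourier 0 NMl; rewrite cos0 expr1n.
under [X in 1 = _ + 2 * X -> _]eq_bigr do rewrite mulr0 cos0 mulr1.
set S := \sum_(0 <= k < _) _ => hS.
have -> : \sum_(0 <= j < M * l) \sum_(0 <= i < h.+1)
    binom_weight N j * cos (2 * j%:R * (pi * i%:R / l%:R)) =
  (l%:R * (\sum_(0 <= j < M) binom_weight N (j * l)) + S) / 2.
  rewrite -(@sum_multiples (binom_weight N) l M)// big_distrr/= -big_split/= big_distrl/=.
  apply: eq_bigr => k _; rewrite -big_distrr/=.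
  have := dirichlet_kernel_odd h k; cbv zeta; rewrite -/l; case: ifP => _ hk.
    have -> : \sum_(0 <= i < h.+1) cos (2 * k%:R * (pi * i%:R / l%:R)) = (l%:R + 1) / 2 :> R.
      by move: hk; lra.
    by field.
  have -> : \sum_(0 <= i < h.+1) cos (2 * k%:R * (pi * i%:R / l%:R)) = 1 / 2 :> R.
    by move: hk; lra.
  by field.
rewrite l2h -mulr_natr -natr1.
have -> : S = (1 + binom_weight N 0) / 2 by move: hS; lra.
by field.
Qed.

Lemma binom_weight_recN n k :
  (n%:R + 1) * (2 * n%:R + 1) * binom_weight n k =
  2 * ((n%:R + 1) ^+ 2 - k%:R ^+ 2) * binom_weight n.+1 k.
Proof.
have [kn|kn] := leqP k n; last first.
  rewrite binom_weight_small// mulr0.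
  have [->|kn1] := eqVneq k n.+1; first by rewrite -(natr1 n) subrr mulr0 mul0r.
  by rewrite binom_weight_small ?mulr0//; lia.
have h1 := congr1 (fun x : nat => x%:R : R) (mul_bin_diag (2 * n).+1 (n + k)).
have h2 := congr1 (fun x : nat => x%:R : R) (mul_bin_down (2 * n).+2 (n + k).+1).
rewrite !natrM (_ : (2 * n).+1%:R = 2 * n%:R + 1) in h1; last by rewrite -natr1 natrM.
rewrite !natrM natrB in h2; last by lia.
rewrite /= -!natr1 natrD in h1.
rewrite /= -!natr1 natrD natrM in h2.
rewrite /binom_weight [4 ^+ n.+1]exprS (_ : 2 * n.+1 = (2 * n).+2)%N; last by lia.
have h4 : 4 ^+ n != 0 :> R by rewrite expf_neq0.
rewrite addSn; move: h1 h2.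
set C0 := 'C(2 * n, _)%:R; set C1 := 'C(_, _)%:R; set C2 := 'C(_, _)%:R => h1 h2.
have e : (n%:R + 1) * (2 * n%:R + 1) * C0 =
         ((n%:R + 1) ^+ 2 - k%:R ^+ 2) / 2 * C2.
  transitivity ((n%:R + 1) * ((n%:R + k%:R + 1) * C1)); first by rewrite -h1; ring.
  transitivity ((n%:R + k%:R + 1) / 2 * ((2 * n%:R + 1 + 1) * C1)); first by field.
  by rewrite h2; field.
by rewrite mulrA e; field.
Qed.

(** The combination [A (q_n - 2 q_(n+1) + q_(n+2)) - B (q_(n+1) - q_(n+2))] with
[A = (2n+3)(2n+1)/2] and [B = 3(2n+3)/2], a discrete version of
[2 n^2 (d/dn)^2 + 3 n (d/dn)], applied to [q_n = cos t ^ (2n)].  When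
[n (sin t)^2] tends to [w], it tends to [omega_term w]. *)
Definition theta_cos n (t : R) : R :=
  (2 * n%:R + 3) / 2 * sin t ^+ 2 * cos t ^+ (2 * n) *
  ((2 * n%:R + 1) * sin t ^+ 2 - 3 * cos t ^+ 2).

(** The same combination applied to [q_n = binom_weight n k].  The factor of
[binom_weight n.+2 k] has no term independent of [k]: the weights [A] and [B]
are the ones that annihilate the central weights. *)
Definition theta_bin n k : R :=
  binom_weight n.+2 k *
  ((2 * (k%:R ^+ 2) ^+ 2 - (3 * n%:R + 5) * k%:R ^+ 2) / ((n%:R + 1) * (n%:R + 2))).

(** [discrete_theta] for [n], [n+1] and [n+2], combined so that the constant
[-1] and the terms of frequency [0] both cancel. *)
Lemma discrete_omega n h : let l := h.*2.+1 in
  \sum_(0 <= j < h.+1) theta_cos n (pi * j%:R / l%:R) =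
  l%:R * \sum_(0 <= j < n.+3) theta_bin n (j * l).
Proof.
move=> l.
pose A := (2 * n%:R + 3) * (2 * n%:R + 1) / 2 : R.
pose B := 3 * (2 * n%:R + 3) / 2 : R.
have hc t : theta_cos n t = A * (cos t ^+ (2 * n) - 2 * cos t ^+ (2 * n.+1)
     + cos t ^+ (2 * n.+2)) - B * (cos t ^+ (2 * n.+1) - cos t ^+ (2 * n.+2)).
  rewrite /theta_cos !mulnS !exprD sin2cos2 /A /B; by field.
have hb k : theta_bin n k = A * (binom_weight n k - 2 * binom_weight n.+1 k
     + binom_weight n.+2 k) - B * (binom_weight n.+1 k - binom_weight n.+2 k).
  have r1 := binom_weight_recN n k; have r2 := binom_weight_recN n.+1 k.
  have n0 : (0 : R) <= n%:R by [].
  have e1 : binom_weight n.+1 k = 2 * ((n%:R + 2) ^+ 2 - k%:R ^+ 2) * binom_weight n.+2 k / ((n%:R + 2) * (2 * n%:R + 3)).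
    apply: (canRL (mulfK _)); first by apply/lt0r_neq0; nra.
    rewrite -(natr1 n) in r2.
    by transitivity (2 * ((n%:R + 1 + 1) ^+ 2 - k%:R ^+ 2) * binom_weight n.+2 k); [rewrite -r2; ring|ring].
  have e2 : binom_weight n k = 2 * ((n%:R + 1) ^+ 2 - k%:R ^+ 2) * binom_weight n.+1 k / ((n%:R + 1) * (2 * n%:R + 1)).
    apply: (canRL (mulfK _)); first by apply/lt0r_neq0; nra.
    by rewrite -r1; ring.
  rewrite e2 e1 /theta_bin /A /B; field.
  by repeat (apply/andP; split); apply/lt0r_neq0; lra.
have hs N : (N < n.+3)%N -> \sum_(0 <= j < h.+1) cos (pi * j%:R / l%:R) ^+ (2 * N) =
   (1 + l%:R * (- binom_weight N 0 + 2 * \sum_(0 <= j < n.+3) binom_weight N (j * l))) / 2.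
  by move=> Nn; have := discrete_theta h Nn; cbv zeta; rewrite -/l; lra.
under eq_bigr do rewrite hc.
rewrite sumrB -!big_distrr/= sumrB big_split/= sumrB -!big_distrr/= !hs//; last by lia.
under [in RHS]eq_bigr do rewrite hb.
rewrite [in RHS]sumrB -![in RHS]big_distrr/= [in RHS]sumrB [in RHS]big_split/= [in RHS]sumrB -![in RHS]big_distrr/=.
(* Frequency 0: the combination of the central weights is zero. *)
have := hb 0%N; rewrite /theta_bin expr0n /= expr0n /= !mulr0 subrr mul0r mulr0.
move=> h0; apply/eqP; rewrite -subr_eq0; apply/eqP.
by rewrite -[RHS](mulr0 (- l%:R / 2)) [in RHS]h0; field.
Qed.

End DiscreteTheta.

(** * Gaussian bounds for cosine powers and binomial weights *)

Section Estimates.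
Context {R : realType}.
Implicit Types (N n h d k : nat).

Lemma ndecr_from0 (f df : R -> R) (b t : R) : (forall x : R, is_derive x (1 : R) f (df x)) ->
  (forall x, 0 <= x <= b -> 0 <= df x) -> 0 <= t <= b -> f 0 <= f t.
Proof.
move=> fdf df0 /andP[t0 tb].
apply: (@ger0_derive1_ndecr R f 0 b) => //.
- by move=> x; rewrite in_itv/= => /andP[/ltW x0 /ltW xb]; rewrite derive1E derive_val df0// x0.
- apply: derivable_within_continuous => x _; exact: ex_derive.
Qed.

Lemma sin_le_id (t : R) : 0 <= t -> sin t <= t.
Proof.
move=> t0; rewrite -subr_ge0.
have := @ndecr_from0 (fun x => x - sin x) (fun x => 1 - cos x) t t.
rewrite sin0 subrr; apply; last by rewrite t0 lexx.
  by move=> x _; rewrite subr_ge0 cos_le1.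
Qed.

Lemma sin_ge_xcos (t : R) : 0 <= t <= pi -> t * cos t <= sin t.
Proof.
move=> t0; rewrite -subr_ge0.
have := @ndecr_from0 (fun x => sin x - x * cos x) (fun x => x * sin x) pi t.
rewrite sin0 mul0r subrr; apply => //.
  move=> x; apply: is_derive_eq; rewrite /GRing.scale/=; ring.
by move=> x x0pi; rewrite mulr_ge0 ?sin_ge0_pi//; case/andP: x0pi.
Qed.

(** A crude constant suffices.  If [cos t >= 1/2] then [sin t >= t / 2] by
[sin_ge_xcos]; otherwise [sin t ^ 2 >= 3/4] while [t < 2]. *)
Lemma sin_sqr_ge (t : R) : 0 <= t <= pi / 2 -> t ^+ 2 / 16 <= sin t ^+ 2.
Proof.
move=> /andP[t0 tpi]; have pi2 := @pihalf_lt2 R.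
have [c2|c2] := leP (1 / 2) (cos t).
  have h : t / 2 <= sin t.
    apply: le_trans (sin_ge_xcos _); last by rewrite t0/=; have := @pi_gt0 R; lra.
    by rewrite ler_wpM2l//; lra.
  by nra.
have c0 : 0 <= cos t by rewrite cos_ge0_pihalf// tpi andbT; have := @pi_gt0 R; lra.
rewrite sin2cos2; nra.
Qed.

Lemma expn_onem_le (y : R) n : 0 <= y <= 1 -> (1 - y) ^+ n <= expR (- (n%:R * y)).
Proof.
move=> /andP[y0 y1]; rewrite -mulrN expRM_natl lerXn2r ?nnegrE ?expR_ge0 ?subr_ge0//.
exact: expR_ge1Dx.
Qed.

Lemma expR_le_onem (y : R) : 0 <= y < 1 -> expR (- (y / (1 - y))) <= 1 - y.
Proof.
move=> /andP[y0 y1]; have y1' : 0 < 1 - y by rewrite subr_gt0.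
rewrite expRN invf_ple ?posrE ?expR_gt0//.
apply: le_trans (expR_ge1Dx _).
by rewrite (_ : 1 + y / (1 - y) = (1 - y)^-1)//; field; exact: lt0r_neq0.
Qed.

Lemma expn_onem_ge (y : R) n : 0 <= y < 1 ->
  expR (- (n%:R * y / (1 - y))) <= (1 - y) ^+ n.
Proof.
move=> y01; rewrite -mulrA -mulrN expRM_natl lerXn2r ?nnegrE ?expR_ge0//.
  by rewrite subr_ge0; case/andP: y01 => _ /ltW.
exact: expR_le_onem.
Qed.

Local Notation p := (@binom_weight R).

Lemma binom_weight_ge0 N k : 0 <= p N k.
Proof. by rewrite /binom_weight divr_ge0. Qed.

Lemma binom_weight_recK N k : (k <= N)%N ->
  (N%:R + k%:R + 1) * p N k.+1 = (N%:R - k%:R) * p N k.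
Proof.
move=> kN; have := congr1 (fun x : nat => x%:R : R) (mul_bin_left (2 * N) (N + k)).
rewrite !natrM natrB; last by lia.
rewrite -natr1 natrD natrM /binom_weight addnS => h.
rewrite mulrA h; ring.
Qed.

(** The successive ratios are [1 - (2k+1)/(N+k+1)], at most
[exp (- (2k+1)/(N+K))] as long as [k < K]; the odd numbers sum to a square. *)
Lemma binom_weight_le N K k : (0 < N + K)%N -> (k <= K)%N ->
  p N k <= p N 0 * expR (- (k%:R ^+ 2 / (N%:R + K%:R))).
Proof.
move=> NK; have NK0 : (0 : R) < N%:R + K%:R by rewrite -natrD ltr0n.
elim: k => [|k IH] kK; first by rewrite expr0n/= mul0r oppr0 expR0 mulr1.
have [Nk|kN] := leqP N k.
  by rewrite binom_weight_small// mulr_ge0 ?expR_ge0 ?binom_weight_ge0.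
have h := binom_weight_recK (ltnW kN).
have d0 : (0 : R) < N%:R + k%:R + 1 by rewrite -natrD natr1 ltr0n.
have -> : p N k.+1 = (1 - (2 * k%:R + 1) / (N%:R + k%:R + 1)) * p N k.
  by apply: (mulfI (lt0r_neq0 d0)); rewrite h; field; exact: lt0r_neq0.
have -> : k.+1%:R ^+ 2 / (N%:R + K%:R) = k%:R ^+ 2 / (N%:R + K%:R) + (2 * k%:R + 1) / (N%:R + K%:R) :> R.
  by rewrite -natr1; field; exact: lt0r_neq0.
rewrite opprD expRD mulrA mulrC ler_pM ?binom_weight_ge0//.
- rewrite subr_ge0 ler_pdivrMr// mul1r.
  have : (k.+1%:R : R) <= N%:R by rewrite ler_nat.
  by rewrite -natr1; lra.
- exact/IH/ltnW.
- apply: le_trans (expR_ge1Dx _); rewrite lerD2l lerN2 ler_wpM2l ?addr_ge0 ?mulr_ge0//.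
  rewrite lef_pV2 ?posrE//.
  have : (k.+1%:R : R) <= K%:R by rewrite ler_nat.
  by rewrite -natr1; lra.
Qed.

(** The inverse ratios are [1 + (2k+1)/(N-k)], at most
[exp ((2k+1)/(N-K+1))] as long as [k < K]. *)
Lemma binom_weight_ge N K k : (K <= N)%N -> (k <= K)%N ->
  p N 0 * expR (- (k%:R ^+ 2 / (N%:R - K%:R + 1))) <= p N k.
Proof.
move=> KN; have NK0 : (0 : R) < N%:R - K%:R + 1 by rewrite -natrB// natr1 ltr0n.
elim: k => [|k IH] kK; first by rewrite expr0n/= mul0r oppr0 expR0 mulr1.
have kN : (k < N)%N by exact: leq_trans KN.
have h := binom_weight_recK (ltnW kN).
have d0 : (0 : R) < N%:R + k%:R + 1 by rewrite -natrD natr1 ltr0n.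
have Nk0 : (0 : R) < N%:R - k%:R by rewrite subr_gt0 ltr_nat.
have -> : p N k.+1 = p N k * ((N%:R + k%:R + 1) / (N%:R - k%:R))^-1.
  apply: (mulfI (lt0r_neq0 d0)); rewrite h; field.
  by rewrite !lt0r_neq0.
have -> : k.+1%:R ^+ 2 / (N%:R - K%:R + 1) = k%:R ^+ 2 / (N%:R - K%:R + 1) + (2 * k%:R + 1) / (N%:R - K%:R + 1) :> R.
  by rewrite -natr1; field; exact: lt0r_neq0.
rewrite opprD expRD mulrA ler_pM ?mulr_ge0 ?expR_ge0 ?binom_weight_ge0//.
  exact/IH/ltnW.
rewrite expRN lef_pV2 ?posrE ?expR_gt0 ?divr_gt0//.
apply: le_trans (expR_ge1Dx _).
have -> : (N%:R + k%:R + 1) / (N%:R - k%:R) = 1 + (2 * k%:R + 1) / (N%:R - k%:R) :> R.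
  by field; exact: lt0r_neq0.
rewrite lerD2l ler_wpM2l ?addr_ge0 ?mulr_ge0// lef_pV2 ?posrE//.
have : (k.+1%:R : R) <= K%:R by rewrite ler_nat.
by rewrite -natr1; lra.
Qed.

Lemma central_rec N : p N.+1 0 = (2 * N%:R + 1) / (2 * (N%:R + 1)) * p N 0.
Proof.
have := @binom_weight_recN R N 0; rewrite [in RHS]expr0n/= subr0.
have N0 : (N%:R + 1 : R) != 0 by rewrite natr1 pnatr_eq0.
move=> h; apply: (mulfI (_ : 2 * (N%:R + 1) ^+ 2 != 0)).
  by rewrite mulf_neq0// expf_neq0.
by rewrite -h; field.
Qed.

(** By Stirling's formula this tends to [1/pi].  Monotonicity and boundedness
are enough here, the limit being determined afterwards in [omega_inv]. *)
Definition central_sqr N : R := N%:R * p N 0 ^+ 2.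

(** The sequence [(2N+1) (p N 0)^2] starts at [1] and decreases. *)
Lemma central_sqr_le1 N : central_sqr N <= 1.
Proof.
suff h : (2 * N%:R + 1) * p N 0 ^+ 2 <= 1.
  apply: le_trans h; rewrite /central_sqr ler_wpM2r ?sqr_ge0//.
  by have : (0 : R) <= N%:R by []; lra.
elim: N => [|N IH]; first by rewrite /binom_weight bin0 mulr0 add0r mul1r divr1 expr1n.
apply: le_trans IH; rewrite central_rec exprMn mulrA ler_wpM2r ?sqr_ge0//.
rewrite expr_div_n mulrA ler_pdivrMr; last by rewrite exprn_gt0// mulr_gt0// natr1 ltr0n.
rewrite -natr1; have : (0 : R) <= N%:R by [].
nra.
Qed.

Lemma central_sqr_nd : {homo central_sqr : n m / (n <= m)%N >-> n <= m}.
Proof.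
apply/nondecreasing_seqP => N; rewrite /central_sqr central_rec.
move: (p N 0) => q; rewrite exprMn [leRHS]mulrA.
rewrite ler_wpM2r ?sqr_ge0// expr_div_n mulrA ler_pdivlMr; last by rewrite exprn_gt0// mulr_gt0// natr1 ltr0n.
rewrite -natr1; have : (0 : R) <= N%:R by [].
nra.
Qed.

Lemma cvg_central_sqr : cvgn central_sqr.
Proof.
apply: nondecreasing_is_cvgn; first exact: central_sqr_nd.
by exists 1 => _ [N _ <-]; exact: central_sqr_le1.
Qed.

End Estimates.

(** * The continuum limit *)

(** With [w = pi y m^2] this is the term of index [m] of [omega y]. *)
Definition omega_term {R : realType} (w : R) : R := (2 * w ^+ 2 - 3 * w) * expR (- w).

Section OmegaTerm.
Context {R : realType}.

Lemma omega_term_le (w : R) : 0 <= w ->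
  `|omega_term w| <= (2 * w ^+ 2 + 3 * w) * expR (- w).
Proof.
move=> w0; rewrite /omega_term normrM [`|expR _|]ger0_norm ?expR_ge0//.
rewrite ler_wpM2r ?expR_ge0// (le_trans (ler_normB _ _))//.
by rewrite !ger0_norm// mulr_ge0// sqr_ge0.
Qed.

Lemma cvgn_series_omega_term (c : R) : 0 < c ->
  cvgn (series (fun j : nat => omega_term (c * j%:R ^+ 2))).
Proof.
move=> c0.
apply: (@cvgn_series_dominated _ _ (fun j => (2 * c ^+ 2 * (j%:R ^+ 2) ^+ 2 + 3 * c * j%:R ^+ 2) *
   expR (- (c * j%:R ^+ 2)))).
  move=> j; apply: le_trans (omega_term_le _) _; first by rewrite mulr_ge0 ?sqr_ge0// ltW.
  by rewrite exprMn !mulrA.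
by apply: cvgn_series_gauss => //; rewrite mulr_ge0 ?sqr_ge0// ltW.
Qed.

End OmegaTerm.

Section ContinuousLimits.
Context {R : realType}.

Lemma cvg_expRN (f : nat -> R) (a : R) : f n @[n --> \oo] --> a ->
  expR (- f n) @[n --> \oo] --> expR (- a).
Proof.
move=> fa; apply: (@continuous_cvg _ _ _ _ _ (fun n => - f n) expR).
  exact: continuous_expR.
exact: cvgN.
Qed.

Lemma cvg_sqrt (f : nat -> R) (a : R) : f n @[n --> \oo] --> a ->
  Num.sqrt (f n) @[n --> \oo] --> Num.sqrt a.
Proof.
by move=> fa; apply: (@continuous_cvg _ _ _ _ _ f Num.sqrt) => //; exact: sqrt_continuous.
Qed.

(** The Gaussian factor comes from [cos t ^ (2n) = (1 - sin t ^ 2)^n], the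
polynomial one from [sin t <= t] and [(n + 2) t^2 <= A]. *)
Lemma theta_cos_le_gauss (n : nat) (t A : R) : 0 <= t <= pi / 2 ->
  (n%:R + 2) * t ^+ 2 <= A ->
  `|theta_cos n t| <= A * (2 * A + 3) * expR (- (n%:R * t ^+ 2 / 16)).
Proof.
move=> /andP[t0 tpi] hA.
have s0 : 0 <= sin t ^+ 2 by rewrite sqr_ge0.
have s1 : sin t ^+ 2 <= 1 by rewrite sin2cos2 lerBlDr lerDl sqr_ge0.
have st : sin t ^+ 2 <= t ^+ 2.
  rewrite lerXn2r ?nnegrE ?sin_le_id// sin_ge0_pi// t0/= (le_trans tpi)//.
  by rewrite ler_pdivrMr// ler_peMr ?pi_ge0// ler1n.
have ts : t ^+ 2 / 16 <= sin t ^+ 2 by rewrite sin_sqr_ge// t0.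
rewrite /theta_cos exprM cos2sin2; move: (sin t ^+ 2) s0 s1 st ts => s s0 s1 st ts.
have n0 : (0 : R) <= n%:R by [].
have ns : (n%:R + 2) * s <= A by apply: le_trans hA; rewrite ler_wpM2l ?addr_ge0.
have A0 : 0 <= A by apply: le_trans ns; rewrite mulr_ge0 ?addr_ge0.
have hC : (1 - s) ^+ n <= expR (- (n%:R * t ^+ 2 / 16)).
  apply: le_trans (expn_onem_le _ _) _; first by rewrite s0.
  by rewrite ler_expR lerN2 -mulrA ler_wpM2l.
rewrite mulrAC normrM; apply: ler_pM => //; last first.
  by rewrite ger0_norm// exprn_ge0 ?subr_ge0.
rewrite normrM; apply: ler_pM => //.
  rewrite ger0_norm; last by rewrite mulr_ge0// divr_ge0// addr_ge0// mulr_ge0.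
  by apply: le_trans ns; rewrite ler_wpM2r//; lra.
by rewrite ler_norml; apply/andP; split; nra.
Qed.

End ContinuousLimits.

Section ScalingLimit.
Context {R : realType}.
Variables (x : R) (x0 : 0 < x).
Implicit Types (h j : nat).

Local Notation p := (@binom_weight R).
(** Here [L] is the odd number of angles, [e = 1 / L] the mesh and [n] the
largest exponent with [n e^2 <= x], so that [r = n e^2] tends to [x].  All
quantities below are written in [r] and [e], whose limits are [x] and [0]. *)
Let L h : nat := h.*2.+1.
Let e h : R := (L h)%:R^-1.
Let n h : nat := Num.truncn ((L h)%:R ^+ 2 * x).
Let r h : R := (n h)%:R * (e h * e h).

Let L0 h : (0 : R) < (L h)%:R. Proof. by rewrite ltr0n. Qed.
Let e_gt0 h : 0 < e h. Proof. by rewrite invr_gt0. Qed.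
Let e_le1 h : e h <= 1. Proof. by rewrite invf_le1// ler1n. Qed.
Let nE h : (n h)%:R = r h * (L h)%:R ^+ 2.
Proof. by rewrite /r /e; field; exact: lt0r_neq0. Qed.

Let nE2 h : (n h).+2%:R = r h * (L h)%:R ^+ 2 + 2.
Proof. by rewrite -nE -natrD addn2. Qed.

Let cvg_e : e h @[h --> \oo] --> (0 : R).
Proof.
apply: (@squeeze_cvgr _ _ _ _ (fun=> 0) (@harmonic R)); [|exact: cvg_cst|exact: cvg_harmonic].
near=> h; rewrite (ltW (e_gt0 h))/= /e lef_pV2 ?posrE//.
by rewrite ler_nat /L -addnn; lia.
Unshelve. all: end_near. Qed.

Let r_bounds h : x - e h * e h <= r h <= x.
Proof.
have Lx0 : 0 <= (L h)%:R ^+ 2 * x by rewrite mulr_ge0 ?exprn_ge0// ltW.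
have /andP[h1 h2] := truncn_itv Lx0; rewrite -/(n h) -natr1 in h1 h2.
have ee0 : 0 < e h * e h by rewrite mulr_gt0.
have LLe : (L h)%:R ^+ 2 * x * (e h * e h) = x.
  by rewrite /e; field; exact: lt0r_neq0.
apply/andP; split.
  by have := ler_wpM2r (ltW ee0) (ltW h2); rewrite LLe mulrDl mul1r -/(r h); lra.
by have := ler_wpM2r (ltW ee0) h1; rewrite LLe.
Qed.

Let cvg_r : r h @[h --> \oo] --> x.
Proof.
apply: (@squeeze_cvgr _ _ _ _ (fun h => x - e h * e h) (fun=> x)).
- by near=> h; exact: r_bounds.
- rewrite -[X in _ --> X]subr0 -[X in _ - X](mulr0 0).
  by apply: cvgB; [exact: cvg_cst|exact: cvgM].
- exact: cvg_cst.
Unshelve. all: end_near. Qed.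

Let r_ge_half : \forall h \near \oo, x / 2 <= r h.
Proof. by apply: (cvgr_ge _ cvg_r); have := x0; lra. Qed.

Let cvg_n : (n h).+2 @[h --> \oo] --> \oo.
Proof.
apply/cvgnyPge => A; near=> h; have xp := x0.
have hr : x / 2 <= r h by near: h.
rewrite -(@ler_nat R) -addn2 natrD nE.
have hA : 2 * A%:R / x <= h%:R by near: h; exact: nbhs_infty_ger.
have hL : (h%:R : R) <= (L h)%:R ^+ 2 by rewrite -natrX ler_nat /L -addnn expnS expn1; nia.
rewrite ler_pdivrMr// in hA; nra.
Unshelve. all: end_near. Qed.

Lemma cvg_sinc j : sin (pi * j%:R * e h) / e h @[h --> \oo] --> pi * j%:R.
Proof.
have c : pi * j%:R * e h @[h --> \oo] --> pi * j%:R * 0.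
  by apply: cvgM => //; exact: cvg_cst.
have t0 h : 0 <= pi * j%:R * e h by rewrite !mulr_ge0 ?pi_ge0// ltW.
apply: (@squeeze_cvgr _ _ _ _ (fun h => pi * j%:R * cos (pi * j%:R * e h)) (fun=> pi * j%:R)).
- near=> h.
  have tpi : pi * j%:R * e h <= pi.
    near: h; apply: (cvgr_le _ c); rewrite mulr0; exact: pi_gt0.
  apply/andP; split; last by rewrite ler_pdivrMr// sin_le_id.
  by rewrite ler_pdivlMr// mulrAC sin_ge_xcos// t0.
- rewrite -[X in _ --> X]mulr1; apply: cvgM; first exact: cvg_cst.
  have cc : cos (pi * j%:R * e h) @[h --> \oo] --> cos (pi * j%:R * 0).
    apply: (@continuous_cvg _ _ _ _ _ (fun h => pi * j%:R * e h) cos) => //.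
    exact: continuous_cos.
  by rewrite mulr0 cos0 in cc.
- exact: cvg_cst.
Unshelve. all: end_near. Qed.

(** With [S = sin (pi j e)^2] of order [e^2] and [n S] tending to [(pi j)^2 x],
the power [(1 - S)^n] is squeezed between two exponentials. *)
Lemma cvg_theta_cos j :
  theta_cos (n h) (pi * j%:R / (L h)%:R) @[h --> \oo] -->
  omega_term ((pi * j%:R) ^+ 2 * x).
Proof.
set w := pi * j%:R; pose v h := sin (w * e h) / e h.
have cv : v h @[h --> \oo] --> w by exact: cvg_sinc.
pose S h := e h * e h * (v h * v h).
have cvv : v h * v h @[h --> \oo] --> w * w by exact: cvgM.
have cee : e h * e h @[h --> \oo] --> (0 * 0 : R) by exact: cvgM.
have cS : S h @[h --> \oo] --> 0 * 0 * (w * w) by exact: cvgM.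
have SE h : sin (w / (L h)%:R) ^+ 2 = S h.
  by rewrite /S /v -/(e h); field; exact: lt0r_neq0.
have cC : (1 - S h) ^+ (n h) @[h --> \oo] --> expR (- (w ^+ 2 * x)).
  apply: (@squeeze_cvgr _ _ _ _ (fun h => expR (- (r h * (v h * v h) / (1 - S h))))
    (fun h => expR (- (r h * (v h * v h))))).
  - near=> h.
    have S1 : S h < 1 by near: h; apply: (cvgr_lt _ cS); rewrite !mul0r.
    have S0 : 0 <= S h by rewrite -SE sqr_ge0.
    have nS : (n h)%:R * S h = r h * (v h * v h) by rewrite /S /r; ring.
    by rewrite -nS expn_onem_ge ?S0// expn_onem_le// S0 ltW.
  - apply: cvg_expRN.
    rewrite (_ : w ^+ 2 * x = x * (w * w) * (1 - 0 * 0 * (w * w))^-1); last by field.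
    apply: cvgM; first exact: cvgM.
    by apply: cvgV; [rewrite !mul0r subr0 oner_eq0|apply: cvgB => //; exact: cvg_cst].
  - apply: cvg_expRN.
    by rewrite (_ : w ^+ 2 * x = x * (w * w)); [exact: cvgM|ring].
rewrite (_ : (fun h => _) = fun h =>
  (2 * r h + 3 * (e h * e h)) * (v h * v h) / 2 * (1 - S h) ^+ n h *
  ((2 * r h + (e h * e h)) * (v h * v h) - 3 * (1 - S h))); last first.
  apply/funext => h; rewrite /theta_cos exprM cos2sin2 SE /S /r; ring.
rewrite (_ : omega_term _ =
  (2 * x + 3 * (0 * 0)) * (w * w) / 2 * expR (- (w ^+ 2 * x)) *
  ((2 * x + 0 * 0) * (w * w) - 3 * (1 - 0 * 0 * (w * w)))); last first.
  by rewrite /omega_term; field.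
apply: cvgM; [apply: cvgM => //; apply: cvgM; [apply: cvgM => //; apply: cvgD|]|
  apply: cvgB; [apply: cvgM => //; apply: cvgD => //|]].
- by apply: cvgM => //; exact: cvg_cst.
- by apply: cvgM => //; exact: cvg_cst.
- exact: cvg_cst.
- by apply: cvgM => //; exact: cvg_cst.
- apply: cvgM; first exact: cvg_cst.
  by apply: cvgB => //; exact: cvg_cst.
Unshelve. all: end_near. Qed.

(** Dominating terms valid for all large [h] and every [j]; the condition
[j <= h] keeps the angle in the range of [theta_cos_le_gauss]. *)
Lemma theta_cos_le : \forall h \near \oo, forall j,
  `| if (j < h.+1)%N then theta_cos (n h) (pi * j%:R / (L h)%:R) else 0 | <=
  (2 * ((x + 2) * pi ^+ 2) ^+ 2 * (j%:R ^+ 2) ^+ 2 +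
   3 * ((x + 2) * pi ^+ 2) * j%:R ^+ 2) * expR (- (x * pi ^+ 2 / 32 * j%:R ^+ 2)).
Proof.
have angle_sqrE (N E J P : R) : N * (P * J * E) ^+ 2 = N * (E * E) * P ^+ 2 * J ^+ 2.
  by ring.
have gauss_factorE (B q : R) : B * q * (2 * (B * q) + 3) = 2 * B ^+ 2 * q ^+ 2 + 3 * B * q.
  by ring.
have exponent_le (a b P q : R) : a / 2 * (P * q) <= b * (P * q) -> a * P / 32 * q <= b * P * q / 16.
  lra.
near=> h => j; have xp := x0; have hr : x / 2 <= r h by near: h.
set q : R := j%:R ^+ 2; set B := (x + 2) * pi ^+ 2.
have q0 : 0 <= q by rewrite sqr_ge0.
have B0 : 0 <= B by rewrite mulr_ge0 ?sqr_ge0//; lra.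
case: ifP => jh; last first.
  by rewrite normr0 mulr_ge0 ?expR_ge0//; have := mulr_ge0 B0 q0; nra.
set t := _ / _; have tE : t = pi * j%:R * e h by [].
have t0 : 0 <= t by rewrite tE !mulr_ge0 ?pi_ge0// ltW.
have tpi : t <= pi / 2.
  rewrite /t -mulrA ler_wpM2l ?pi_ge0// ler_pdivrMr// mulrC ler_pdivlMr//.
  by rewrite -natrM ler_nat /L -muln2; lia.
have nt : (n h)%:R * t ^+ 2 = r h * pi ^+ 2 * q by rewrite tE angle_sqrE.
have /andP[_ rx] := r_bounds h.
have hB : ((n h)%:R + 2) * t ^+ 2 <= B * q.
  have tE2 : 2 * t ^+ 2 = 2 * (e h * e h) * pi ^+ 2 * q.
    by rewrite tE angle_sqrE.
  have ee1 : e h * e h <= 1 by rewrite mulr_ile1// ltW.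
  have hx : r h + 2 * (e h * e h) <= x + 2 by rewrite lerD// ler_piMr.
  rewrite mulrDl nt tE2.
  have -> : r h * pi ^+ 2 * q + 2 * (e h * e h) * pi ^+ 2 * q = (r h + 2 * (e h * e h)) * pi ^+ 2 * q by rewrite !mulrDl.
  apply: ler_wpM2r => //.
  by apply: ler_wpM2r hx; exact: sqr_ge0.
apply: le_trans (theta_cos_le_gauss _ hB) _; first by rewrite t0.
rewrite nt; apply: ler_pM; rewrite ?expR_ge0//.
- by have := mulr_ge0 B0 q0; nra.
- by rewrite gauss_factorE.
- rewrite ler_expR lerN2.
  have := ler_wpM2r (mulr_ge0 (sqr_ge0 (@pi R)) q0) hr.
  exact: exponent_le.
Unshelve. all: end_near. Qed.

Let c0 := limn (@central_sqr R).

(** The square of the left side is [central_sqr] at [n + 2], divided by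
[(n + 2) e^2], which tends to [x]. *)
Lemma cvg_scaled_central :
  (L h)%:R * p (n h).+2 0 @[h --> \oo] --> Num.sqrt (c0 / x).
Proof.
rewrite (_ : (fun h => _) = fun h =>
  Num.sqrt (central_sqr (n h).+2 / (r h + 2 * (e h * e h)))); last first.
  apply/funext => h.
  rewrite -[LHS]ger0_norm; last by rewrite mulr_ge0// binom_weight_ge0.
  rewrite -sqrtr_sqr; congr Num.sqrt.
  have r0 : 0 <= r h by rewrite mulr_ge0// mulr_ge0// ltW.
  have N0 : (n h).+2%:R != 0 :> R by rewrite pnatr_eq0.
  have -> : r h + 2 * (e h * e h) = (n h).+2%:R * (e h * e h) by rewrite /r -addn2 natrD; ring.
  rewrite /central_sqr /e; field.
  by rewrite lt0r_neq0//= addrC -natrD addn2.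
apply: cvg_sqrt.
rewrite -[in X in _ --> X](addr0 x) -[in X in _ --> X](mulr0 2) -[in X in _ --> X](mulr0 0).
apply: cvgM.
  have := @cvg_comp _ _ _ (fun h => (n h).+2) (@central_sqr R) _ _ _ cvg_n (@cvg_central_sqr R).
  exact.
apply: cvgV; first by rewrite !mulr0 addr0 lt0r_neq0.
apply: cvgD => //; apply: cvgM; first exact: cvg_cst.
exact: cvgM.
Qed.

Let binE h j : (L h)%:R * theta_bin (n h) (j * L h) =
  (L h)%:R * p (n h).+2 (j * L h) *
  ((2 * (j%:R ^+ 2) ^+ 2 - (3 * r h + 5 * (e h * e h)) * j%:R ^+ 2) /
   ((r h + e h * e h) * (r h + 2 * (e h * e h)))).
Proof.
have r0 : 0 <= r h by rewrite mulr_ge0// mulr_ge0// ltW.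
have n0 : (0 : R) <= (n h)%:R by [].
rewrite /theta_bin mulrA natrM /r /e; field.
by rewrite !lt0r_neq0//; nra.
Qed.

(** The local limit theorem: [binom_weight_ge] and [binom_weight_le] with
[k = K = j L] squeeze the weights between two Gaussians with the same limit. *)
Lemma cvg_theta_bin j : (L h)%:R * theta_bin (n h) (j * L h) @[h --> \oo] -->
  Num.sqrt (c0 / x) * omega_term (j%:R ^+ 2 / x).
Proof.
set q : R := j%:R ^+ 2.
have cee : e h * e h @[h --> \oo] --> (0 * 0 : R) by exact: cvgM.
have ck k : k * (e h * e h) @[h --> \oo] --> k * (0 * 0 : R).
  by apply: cvgM => //; exact: cvg_cst.
have cj : j%:R * e h @[h --> \oo] --> j%:R * (0 : R) by apply: cvgM => //; exact: cvg_cst.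
have xn0 : x != 0 by exact: lt0r_neq0.
have cp : (L h)%:R * p (n h).+2 (j * L h) @[h --> \oo] --> Num.sqrt (c0 / x) * expR (- (q / x)).
  apply: (@squeeze_cvgr _ _ _ _
    (fun h => (L h)%:R * p (n h).+2 0 * expR (- (q / (r h + 2 * (e h * e h) - j%:R * e h + 1 * (e h * e h)))))
    (fun h => (L h)%:R * p (n h).+2 0 * expR (- (q / (r h + 2 * (e h * e h) + j%:R * e h))))).
  - near=> h; have xp := x0.
    have hr : x / 2 <= r h by near: h.
    have hj : j%:R * e h <= x / 2.
      by near: h; apply: (cvgr_le _ cj); rewrite mulr0 divr_gt0.
    have jN : (j * L h <= (n h).+2)%N.
      rewrite -(@ler_nat R) natrM nE2.
      have : j%:R * (L h)%:R = j%:R * e h * (L h)%:R ^+ 2 by rewrite /e; field; exact: lt0r_neq0.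
      have LL : 0 < (L h)%:R ^+ 2 :> R by rewrite exprn_gt0.
      by move=> ->; have := ler_wpM2r (ltW LL) (le_trans hj hr); lra.
    have j0 : (0 : R) <= j%:R by [].
    have ee0 : 0 < e h * e h by rewrite mulr_gt0.
    apply/andP; split.
      rewrite -[leLHS]mulrA ler_pM2l//.
      have := @binom_weight_ge R _ _ _ jN (leqnn _).
      rewrite (_ : (j * L h)%:R ^+ 2 / _ = q / (r h + 2 * (e h * e h) - j%:R * e h + 1 * (e h * e h)))//.
      rewrite natrM nE2 /q /e; field.
      rewrite lt0r_neq0//=; apply/lt0r_neq0.
      have : (j * L h)%:R <= (n h).+2%:R :> R by rewrite ler_nat.
      by rewrite natrM nE2; lra.
    rewrite -[leRHS]mulrA ler_pM2l//.
    have := @binom_weight_le R (n h).+2 _ _ _ (leqnn (j * L h)%N).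
    rewrite (_ : (j * L h)%:R ^+ 2 / _ = q / (r h + 2 * (e h * e h) + j%:R * e h)); first exact.
    rewrite natrM nE2 /q /e; field.
    rewrite lt0r_neq0//=; apply/lt0r_neq0.
    have : 0 <= (j * L h)%:R :> R by [].
    have : 0 < (n h).+2%:R :> R by rewrite ltr0n.
    by rewrite natrM nE2; lra.
  - apply: cvgM; first exact: cvg_scaled_central.
    apply: cvg_expRN.
    rewrite (_ : q / x = q / (x + 2 * (0 * 0) - j%:R * 0 + 1 * (0 * 0))); last first.
      by rewrite !mulr0 subr0 !addr0.
    apply: cvgM; first exact: cvg_cst.
    apply: cvgV; first by rewrite !mulr0 subr0 !addr0.
    by apply: cvgD => //; apply: cvgB => //; apply: cvgD.
  - apply: cvgM; first exact: cvg_scaled_central.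
    apply: cvg_expRN.
    rewrite (_ : q / x = q / (x + 2 * (0 * 0) + j%:R * 0)); last first.
      by rewrite !mulr0 !addr0.
    apply: cvgM; first exact: cvg_cst.
    apply: cvgV; first by rewrite !mulr0 !addr0.
    by apply: cvgD => //; apply: cvgD.
under eq_fun do rewrite binE.
rewrite (_ : _ * omega_term _ = Num.sqrt (c0 / x) * expR (- (q / x)) *
  ((2 * q ^+ 2 - (3 * x + 5 * (0 * 0)) * q) / ((x + 1 * (0 * 0)) * (x + 2 * (0 * 0))))); last first.
  rewrite /omega_term -mulrA [expR _ * _]mulrC; congr (_ * (_ * _)).
  by rewrite !mulr0 !addr0; field.
apply: cvgM; first exact: cp.
apply: cvgM; last first.
  apply: cvgV; first by rewrite !mulr0 !addr0 mulf_neq0.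
  apply: cvgM; apply: cvgD => //.
  by rewrite mul1r.
apply: cvgB; first exact: cvg_cst.
apply: cvgM; last exact: cvg_cst.
apply: cvgD => //; apply: cvgM => //; exact: cvg_cst.
Unshelve. all: end_near. Qed.

(** Weights beyond [n + 2] vanish, and below it [binom_weight_le] with
[K = n + 2] provides a decay rate independent of [j]. *)
Lemma theta_bin_le : \forall h \near \oo, forall j,
  `| (L h)%:R * theta_bin (n h) (j * L h) | <=
  ((Num.sqrt (c0 / x) + 1) * (4 / x ^+ 2) * 2 * (j%:R ^+ 2) ^+ 2 +
   (Num.sqrt (c0 / x) + 1) * (4 / x ^+ 2) * (3 * x + 5) * j%:R ^+ 2)
  * expR (- ((2 * (x + 2))^-1 * j%:R ^+ 2)).
Proof.
near=> h => j; have xp := x0; have hr : x / 2 <= r h by near: h.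
have hp : (L h)%:R * p (n h).+2 0 <= Num.sqrt (c0 / x) + 1.
  by near: h; apply: (cvgr_le _ cvg_scaled_central); rewrite ltrDl.
set q : R := j%:R ^+ 2; set B := Num.sqrt (c0 / x) + 1 in hp *.
have q0 : 0 <= q by rewrite sqr_ge0.
have /andP[_ rx] := r_bounds h.
have ee0 : 0 < e h * e h by rewrite mulr_gt0.
have ee1 : e h * e h <= 1 by rewrite mulr_ile1// ltW.
have B0 : 0 <= B by apply: le_trans hp; rewrite mulr_ge0// binom_weight_ge0.
rewrite binE normrM.
have h1 : `|(L h)%:R * p (n h).+2 (j * L h)| <= B * expR (- ((2 * (x + 2))^-1 * q)).
  rewrite ger0_norm; last by rewrite mulr_ge0// binom_weight_ge0.
  apply: le_trans (ler_wpM2r (expR_ge0 _) hp); rewrite -mulrA ler_wpM2l//.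
  have [jN|Nj] := leqP (j * L h) (n h).+2; last first.
    by rewrite binom_weight_small// mulr_ge0 ?expR_ge0 ?binom_weight_ge0.
  apply: le_trans (binom_weight_le _ jN) _; first by lia.
  rewrite ler_wpM2l ?binom_weight_ge0// ler_expR lerN2.
  have -> : (j * L h)%:R ^+ 2 / ((n h).+2%:R + (n h).+2%:R) = (2 * (r h + 2 * (e h * e h)))^-1 * q.
    rewrite natrM nE2 /q /e; field.
    have r0 : 0 < r h by lra.
    rewrite lt0r_neq0//=; apply/andP; split; apply/lt0r_neq0; last by nra.
    by have := mulr_gt0 r0 (exprn_gt0 2 (L0 h)); lra.
  by rewrite ler_wpM2r// lef_pV2 ?posrE; lra.
have h2 : `|(2 * q ^+ 2 - (3 * r h + 5 * (e h * e h)) * q) /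
   ((r h + e h * e h) * (r h + 2 * (e h * e h)))| <= (4 / x ^+ 2) * (2 * q ^+ 2 + (3 * x + 5) * q).
  rewrite normrM mulrC; apply: ler_pM => //.
    rewrite normfV ger0_norm; last by rewrite mulr_ge0//; lra.
    have -> : 4 / x ^+ 2 = ((x / 2) * (x / 2))^-1 by field; exact: lt0r_neq0.
    rewrite lef_pV2 ?posrE ?mulr_gt0//; [|lra..].
    by apply: ler_pM; lra.
  apply: le_trans (ler_normB _ _) _.
  rewrite ger0_norm ?mulr_ge0 ?sqr_ge0// ger0_norm; last by rewrite mulr_ge0//; lra.
  by rewrite lerD2l ler_wpM2r//; lra.
apply: le_trans (ler_pM _ _ h1 h2) _ => //.
by rewrite le_eqVlt; apply/orP; left; apply/eqP; ring.
Unshelve. all: end_near. Qed.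

(** Pass to the limit on both sides of [discrete_omega], viewed as an identity
between series with finitely many nonzero terms. *)
Lemma omega_scaling_limit :
  limn (series (fun j => omega_term ((pi * j%:R) ^+ 2 * x))) =
  Num.sqrt (c0 / x) * limn (series (fun j => omega_term (j%:R ^+ 2 / x))).
Proof.
have pi0 := @pi_gt0 R; have x2 : 0 < x + 2 by have := x0; lra.
have B0 : 0 <= (Num.sqrt (c0 / x) + 1) * (4 / x ^+ 2) by rewrite mulr_ge0 ?addr_ge0 ?sqrtr_ge0// divr_ge0// sqr_ge0.
have H1 : limn (series (fun j => if (j < h.+1)%N then theta_cos (n h) (pi * j%:R / (L h)%:R) else 0)) @[h --> \oo] -->
  limn (series (fun j => omega_term ((pi * j%:R) ^+ 2 * x))).
  apply: tannery theta_cos_le _ _.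
    apply: cvgn_series_gauss; rewrite ?mulr_ge0 ?exprn_ge0 ?mulr_ge0 ?exprn_ge0 ?(ltW x2) ?pi_ge0//.
    by rewrite divr_gt0// mulr_gt0// exprn_gt0.
  move=> j. refine (cvg_trans (near_eq_cvg _) (@cvg_theta_cos j)); near=> h.
  by rewrite ifT// ltnS; near: h; exact: nbhs_infty_ge.
have H2 : limn (series (fun j => (L h)%:R * theta_bin (n h) (j * L h))) @[h --> \oo] -->
  limn (series (fun j => Num.sqrt (c0 / x) * omega_term (j%:R ^+ 2 / x))).
  apply: tannery theta_bin_le _ cvg_theta_bin.
  have x35 : 0 <= 3 * x + 5 by have := x0; lra.
  by apply: cvgn_series_gauss; [exact: mulr_ge0|exact: mulr_ge0|rewrite invr_gt0 mulr_gt0].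
have E h : limn (series (fun j => if (j < h.+1)%N then theta_cos (n h) (pi * j%:R / (L h)%:R) else 0)) =
  limn (series (fun j => (L h)%:R * theta_bin (n h) (j * L h))) :> R.
  rewrite (@limn_series_finite _ _ h.+1); last by move=> k hk; rewrite ltnNge hk.
  rewrite (@limn_series_finite _ _ (n h).+3); last first.
    move=> k hk; rewrite /theta_bin binom_weight_small ?mul0r ?mulr0//.
    by rewrite (leq_trans hk)// leq_pmulr.
  rewrite /series/= -big_distrr/= -discrete_omega big_nat [RHS]big_nat.
  by apply: eq_bigr => j /andP[_ ->].
rewrite (funext E) in H1; rewrite -(cvg_lim _ H1)// (cvg_lim _ H2)//.
rewrite (_ : series _ = fun n => Num.sqrt (c0 / x) * series (fun j => omega_term (j%:R ^+ 2 / x)) n); last first.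
  by apply/funext => k; rewrite /series/= big_distrr.
apply/cvg_lim => //; apply: cvgM; first exact: cvg_cst.
under [X in series X]eq_fun do rewrite mulrC.
by apply: cvgn_series_omega_term; rewrite invr_gt0.
Unshelve. all: end_near. Qed.

End ScalingLimit.

(** * The functional equation, positivity and decay of omega *)

Section Omega.
Context {R : realType}.
Implicit Types (y : R) (j : nat).

Let term y := fun j : nat => omega_term (pi * y * j%:R ^+ 2).

(** The term of index [0] vanishes, so that the series may start there, as the
discrete sums do. *)
Lemma omegaE y : omega y = limn (series (term y)).
Proof.
rewrite /omega; congr (limn _); apply/funext => -[|N]; rewrite /series/=; first by rewrite !big_geq.
rewrite [RHS]big_ltn// [X in _ = X + _](_ : _ = 0) ?add0r; last first.
  by rewrite /term /omega_term expr0n/= !mulr0 expr0n/= mulr0 subrr mul0r.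
apply: eq_bigr => m _; rewrite /term /omega_term; congr (_ * expR _); ring.
Qed.

(** [22 = 2 * 8 + 3 * 2], from the constants of [poly_expR_le]. *)
Lemma omega_term_le_expR (w : R) : 0 <= w -> `|omega_term w| <= 22 * expR (- (w / 2)).
Proof.
move=> w0; apply: le_trans (omega_term_le w0) _.
have [h1 h2] := poly_expR_le w0.
have -> : expR (- w) = expR (- (w / 2)) * expR (- (w / 2)) by rewrite -expRD; congr expR; field.
rewrite mulrA ler_wpM2r ?expR_ge0//.
have E0 := expR_ge0 (- (w / 2)); have EE := expRxMexpNx_1 (w / 2).
have := ler_wpM2r E0 h1; have := ler_wpM2r E0 h2; rewrite -!mulrA EE; lra.
Qed.

Lemma natr_le_sqr j : (j%:R : R) <= j%:R ^+ 2.
Proof. by rewrite -natrX ler_nat; case: j => // j; rewrite expnS expn1 leq_pmulr. Qed.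

Lemma term_le (a : R) y j : 0 <= a <= y -> `|term y j| <= 22 * expR (- (a * j%:R)).
Proof.
move=> /andP[a0 ay]; have y0 := le_trans a0 ay.
apply: le_trans (omega_term_le_expR _) _; first by rewrite !mulr_ge0 ?pi_ge0// sqr_ge0.
rewrite ler_wpM2l// ler_expR lerN2.
have -> : pi * y * j%:R ^+ 2 / 2 = pi / 2 * (y * j%:R ^+ 2) by field.
rewrite -[leLHS]mul1r ler_pM ?mulr_ge0 ?pihalf_ge1//.
by rewrite ler_pM// natr_le_sqr.
Qed.

Lemma cvg_omega_series y : 0 < y -> cvgn (series (term y)).
Proof.
move=> y0; apply: (@cvgn_series_dominated _ _ (fun j => 22 * expR (- (y * j%:R)))) => [j|].
  by rewrite term_le// lexx ltW.
exact: cvgn_series_expR.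
Qed.

Lemma omega_continuous y : 0 < y -> {for y, continuous (@omega R)}.
Proof.
move=> y0; suff h : omega x @[x --> y] --> omega y by exact: h.
apply/(@cvg_nbhsP _ R^o) => u uy.
rewrite (_ : (fun n => omega (u n)) = fun n => limn (series (term (u n)))); last first.
  by apply/funext => n; rewrite omegaE.
rewrite omegaE.
have y2 : 0 < y / 2 by rewrite divr_gt0.
apply: (@tannery R (fun n => term (u n)) (term y) (fun j => 22 * expR (- (y / 2 * j%:R)))).
  near=> n => j; apply: term_le; rewrite (ltW y2)/=.
  by near: n; apply: (cvgr_ge _ uy); lra.
  exact: cvgn_series_expR.
move=> j.
have cw : pi * u n * j%:R ^+ 2 @[n --> \oo] --> pi * y * j%:R ^+ 2.
  by apply: cvgM; [apply: cvgM => //; exact: cvg_cst|exact: cvg_cst].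
rewrite /term /omega_term; apply: cvgM; last exact: cvg_expRN.
apply: cvgB; last by apply: cvgM => //; exact: cvg_cst.
apply: cvgM; first exact: cvg_cst.
rewrite (_ : (fun n => _) = fun n => (pi * u n * j%:R ^+ 2) * (pi * u n * j%:R ^+ 2)).
  by rewrite expr2; exact: cvgM.
by apply/funext => n; rewrite expr2.
Unshelve. all: end_near. Qed.

(** For [y >= 1] all terms are nonnegative, since [pi y m^2 >= 2 > 3/2] for
[m >= 1]. *)
Lemma omega_gt0_ge1 y : 1 <= y -> 0 < omega y.
Proof.
move=> y1; have y0 : 0 < y by apply: lt_le_trans y1.
have h j : 0 <= term y j.
  rewrite /term /omega_term; case: j => [|j].
    by rewrite expr0n/= mulr0 expr0n/= !mulr0 subrr mul0r.
  rewrite mulr_ge0 ?expR_ge0//; set w := pi * _ * _.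
  suff : 2 <= w by nra.
  rewrite /w -mulrA -[leLHS]mulr1 ler_pM ?pi_ge2//.
  by rewrite -[leLHS]mulr1 ler_pM//  exprn_ege1// ler1n.
have nd : {homo series (term y) : n m / (n <= m)%N >-> n <= m}.
  by apply: nondecreasing_series => k _ _.
rewrite omegaE; apply: lt_le_trans (nondecreasing_cvgn_le nd (cvg_omega_series y0) 2).
rewrite /series/= big_nat_recr//= big_nat1 ltr_wpDl//.
rewrite /term /omega_term expr1n mulr1 mulr_gt0 ?expR_gt0//.
have : 2 <= pi * y by rewrite -[leLHS]mulr1 ler_pM ?pi_ge2.
nra.
Qed.

Let c0 := limn (@central_sqr R).

(** [omega_scaling_limit] at [x = y / pi]. *)
Lemma omega_scaling y : 0 < y -> omega y = Num.sqrt (c0 * pi / y) * omega y^-1.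
Proof.
move=> y0; have pi0 := lt0r_neq0 (@pi_gt0 R); have yn0 := lt0r_neq0 y0.
have e1 (c p : R) : p != 0 -> c / (y / p) = c * p / y by move=> pn0; field; rewrite yn0.
have e2 (p q : R) : p != 0 -> (p * q) ^+ 2 * (y / p) = p * y * q ^+ 2 by move=> pn0; field.
have := omega_scaling_limit (divr_gt0 y0 (@pi_gt0 R)).
rewrite !omegaE -/c0 (_ : c0 / (y / pi) = c0 * pi / y); last exact: e1.
move=> h; rewrite (_ : term y = fun j => omega_term ((pi * j%:R) ^+ 2 * (y / pi))); last first.
  by apply/funext => j; rewrite /term e2.
rewrite h; congr *%R; congr (limn (series _)).
apply/funext => j; rewrite /term e1//; congr omega_term; ring.
Qed.

(** Evaluating [omega_scaling] at [1] forces [c0 * pi = 1], because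
[omega 1 > 0]. *)
Lemma omega_inv y : 0 < y -> omega y^-1 = Num.sqrt y * omega y.
Proof.
move=> y0; have w1 := omega_gt0_ge1 (lexx 1).
have := omega_scaling (@ltr01 R); rewrite invr1 mulr1 => h.
have s1 : Num.sqrt (c0 * pi) = 1.
  by apply: (mulIf (lt0r_neq0 w1)); rewrite mul1r -h.
have c1 : c0 * pi = 1.
  have c0pi : 0 <= c0 * pi.
    by rewrite leNgt; apply/negP => /ltW c; move: s1; rewrite ler0_sqrtr// => /esym/eqP; rewrite oner_eq0.
  by rewrite -(sqr_sqrtr c0pi) s1 expr1n.
rewrite [in RHS]omega_scaling// c1 mul1r mulrA -sqrtrM ?(ltW y0)// mulfV ?lt0r_neq0//.
by rewrite sqrtr1 mul1r.
Qed.

Lemma omega_gt0 y : 0 < y -> 0 < omega y.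
Proof.
move=> y0; have [y1|/ltW y1] := leP 1 y; first exact: omega_gt0_ge1.
rewrite -[y]invrK omega_inv ?invr_gt0// mulr_gt0 ?sqrtr_gt0 ?invr_gt0//.
by apply: omega_gt0_ge1; rewrite invf_ge1.
Qed.

(** Sum of a majorant of the series of [exp y * omega y], uniform for [y >= 1]. *)
Definition omega_bound : R := limn (series (fun j => 22 * expR 1 * expR (- (1 * j%:R)))).

(** For [j >= 1], [pi y j^2 / 2 - y >= j - 1]; this produces the factor
[exp 1] in [omega_bound]. *)
Lemma omega_le y : 1 <= y -> omega y <= omega_bound * expR (- y).
Proof.
move=> y1; have y0 : 0 < y by apply: lt_le_trans y1.
pose M j : R := 22 * expR 1 * expR (- (1 * j%:R)).
have cM : cvgn (series M) by exact: cvgn_series_expR.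
have h j : `|expR y * term y j| <= M j.
  have M0 : 0 <= M j by rewrite !mulr_ge0 ?expR_ge0.
  case: j M0 => [|j] M0.
    by rewrite /term /omega_term expr0n/= !mulr0 expr0n/= mulr0 subrr mul0r mulr0 normr0.
  rewrite normrM ger0_norm ?expR_ge0//.
  apply: le_trans (ler_wpM2l (expR_ge0 _) (omega_term_le_expR _)) _.
    by rewrite !mulr_ge0 ?pi_ge0 ?sqr_ge0// ltW.
  rewrite (mulrCA (expR y)) -(expRD y) /M/= -[leRHS]mulrA -(expRD 1) ler_wpM2l// ler_expR.
  have j1 : (1 : R) <= j.+1%:R by rewrite ler1n.
  have := @pihalf_ge1 R; set p := pi / 2 => p1.
  have -> : pi * y * j.+1%:R ^+ 2 / 2 = p * (y * j.+1%:R ^+ 2) by rewrite /p; field.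
  have : y * j.+1%:R ^+ 2 <= p * (y * j.+1%:R ^+ 2).
    by rewrite ler_peMl// mulr_ge0 ?sqr_ge0// ltW.
  nra.
have cT := cvg_omega_series y0.
have cE : series (fun j => expR y * term y j) @ \oo --> expR y * omega y.
  rewrite (_ : series _ = fun n => expR y * series (term y) n); last first.
    by apply/funext => n; rewrite /series/= big_distrr.
  by rewrite omegaE; apply: cvgM => //; exact: cvg_cst.
have := series_tail_le 0 h cM.
rewrite !seriesEnat /= !big_geq// !subr0 (cvg_lim _ cE)// => hle.
rewrite expRN ler_pdivlMr ?expR_gt0// mulrC.
exact: le_trans (ler_norm _) hle.
Qed.

Lemma omega_bound_ge0 : 0 <= omega_bound.
Proof.
rewrite -(@pmulr_lge0 _ (expR (-1))) ?expR_gt0//.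
by apply: le_trans (omega_le (lexx 1)); rewrite ltW// omega_gt0_ge1.
Qed.

End Omega.

(** * The Gauss series with positive parameters *)

Section Hypergeometric.
Context {R : realType}.
Implicit Types (a b c z : R) (n m k : nat).

Lemma pochhammerS a n : pochhammer a n.+1 = pochhammer a n * (a + n%:R).
Proof. by rewrite /pochhammer big_ord_recr. Qed.

Lemma pochhammer_gt0 a n : 0 < a -> 0 < pochhammer a n.
Proof. by move=> a0; apply: prodr_gt0 => i _; rewrite ltr_wpDr. Qed.

Definition hyp_coef a b c k : R :=
  pochhammer a k * pochhammer b k / (pochhammer c k * k`!%:R).

Lemma hyp_coef0 a b c : hyp_coef a b c 0 = 1.
Proof. by rewrite /hyp_coef /pochhammer !big_ord0 fact0 !mulr1 divr1. Qed.

Lemma hyp_coef_gt0 a b c k : 0 < a -> 0 < b -> 0 < c -> 0 < hyp_coef a b c k.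
Proof.
move=> a0 b0 c0.
by rewrite divr_gt0// mulr_gt0 ?pochhammer_gt0// ltr0n fact_gt0.
Qed.

Lemma hyp_coefS a b c k : 0 < c ->
  hyp_coef a b c k.+1 * ((c + k%:R) * k.+1%:R) =
  hyp_coef a b c k * ((a + k%:R) * (b + k%:R)).
Proof.
move=> c0; rewrite /hyp_coef !pochhammerS factS natrM.
have ck : c + k%:R != 0 by rewrite lt0r_neq0// ltr_wpDr.
have pk : pochhammer c k != 0 by rewrite lt0r_neq0// pochhammer_gt0.
have k1 : k.+1%:R != 0 :> R by rewrite pnatr_eq0.
have fk : k`!%:R != 0 :> R by rewrite pnatr_eq0 -lt0n fact_gt0.
move: (k.+1%:R : R) (k`!%:R : R) (pochhammer c k) (k%:R : R) k1 fk pk ck.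
by move=> u v w t u0 v0 w0 t0; field; rewrite u0 v0 w0 t0.
Qed.

(** The ratio of consecutive coefficients is [(a+k)(b+k) / ((c+k)(1+k))], at
most [1] once [k >= a b], because [a + b <= c]. *)
Lemma hyp_coef_bounded a b c : 0 < a -> 0 < b -> 0 < c -> a + b <= c ->
  exists H, forall k, hyp_coef a b c k <= H.
Proof.
move=> a0 b0 c0 abc; set t := hyp_coef a b c.
pose K := (Num.truncn (a * b)).+1.
have t0 k : 0 <= t k by rewrite ltW// hyp_coef_gt0.
have tS k : (K <= k)%N -> t k.+1 <= t k.
  move=> Kk; have p0 : 0 < (c + k%:R) * k.+1%:R by rewrite mulr_gt0// ltr_wpDr.
  rewrite -(ler_pM2r p0) hyp_coefS// ler_wpM2l//.
  have : a * b <= k%:R.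
    have /andP[_ /ltW h] := truncn_itv (mulr_ge0 (ltW a0) (ltW b0)).
    by apply: le_trans h _; rewrite ler_nat.
  have : (0 : R) <= k%:R by [].
  rewrite -natr1; nra.
exists (\sum_(0 <= k < K.+1) t k) => k.
have [kK|Kk] := leqP k K.
  by rewrite big_mkord (bigD1 (Ordinal (kK : (k < K.+1)%N)))//= lerDl sumr_ge0.
elim: k Kk => // k IH; rewrite ltnS leq_eqVlt => /predU1P[<-|Kk].
  apply: le_trans (tS _ (leqnn _)) _.
  by rewrite big_nat_recr//= ler_wpDl// sumr_ge0.
exact: le_trans (tS _ (ltnW Kk)) (IH Kk).
Qed.

Section Bounded.
Variables (a b c H : R).
Hypotheses (a0 : 0 < a) (b0 : 0 < b) (c0 : 0 < c).
Hypothesis tH : forall k, hyp_coef a b c k <= H.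

Let t := hyp_coef a b c.
Let t0 k : 0 <= t k. Proof. by rewrite ltW// hyp_coef_gt0. Qed.

Lemma hyp_bound_ge1 : 1 <= H.
Proof. by rewrite -(hyp_coef0 a b c). Qed.

(** Comparison with the geometric series. *)
Lemma hyp_partial_le z M : 0 <= z < 1 ->
  \sum_(0 <= k < M) t k * z ^+ k <= H / (1 - z).
Proof.
move=> /andP[z0 z1].
have h0 k : 0 <= t k * z ^+ k by rewrite mulr_ge0// exprn_ge0.
have z1n : `|z| < 1 by rewrite ger0_norm.
have nd : {homo series (geometric H z) : n m / (n <= m)%N >-> n <= m}.
  apply: nondecreasing_series => k _ _ /=; rewrite mulr_ge0 ?exprn_ge0//.
  exact: le_trans hyp_bound_ge1.
have -> : H / (1 - z) = limn (series (geometric H z)).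
  by apply/esym/cvg_lim => //; exact: cvg_geometric_series.
apply: le_trans (nondecreasing_cvgn_le nd (is_cvg_geometric_series z1n) M).
by apply: ler_sum => k _ /=; rewrite ler_wpM2r// exprn_ge0.
Qed.

Lemma cvg_hyp2F1 z : 0 <= z < 1 ->
  \sum_(0 <= k < M) t k * z ^+ k @[M --> \oo] --> hyp2F1 a b c z.
Proof.
move=> z01.
suff : cvgn (fun M => \sum_(0 <= k < M) t k * z ^+ k) by [].
apply: nondecreasing_is_cvgn.
  apply: nondecreasing_series => k _ _; rewrite mulr_ge0// exprn_ge0//.
  by case/andP: z01.
by exists (H / (1 - z)) => _ [M _ <-]; exact: hyp_partial_le.
Qed.

Lemma hyp2F1_ge1 z : 0 <= z < 1 -> 1 <= hyp2F1 a b c z.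
Proof.
move=> z01; have cz := cvg_hyp2F1 z01.
have nd : {homo (fun M => \sum_(0 <= k < M) t k * z ^+ k) : n m / (n <= m)%N >-> n <= m}.
  apply: nondecreasing_series => k _ _; rewrite mulr_ge0// exprn_ge0//.
  by case/andP: z01.
have := nondecreasing_cvgn_le nd (cvgP _ cz) 1.
by rewrite big_nat1 /t hyp_coef0 expr0 mulr1.
Qed.

End Bounded.

End Hypergeometric.

(** * Pochhammer identities *)

Section Coefficients.
Context {R : realType}.
Implicit Types (n m : nat).

(** Two consecutive factors [(3/2+n+2k) (3/2+n+2k+1)] are
[4 (n/2+3/4+k) (n/2+5/4+k)]. *)
Lemma pochhammer_duplication n m :
  pochhammer (3 / 2) n * (pochhammer (n%:R / 2 + 3 / 4) m * pochhammer (n%:R / 2 + 5 / 4) m) * 4 ^+ m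
  = pochhammer (3 / 2) (n + 2 * m) :> R.
Proof.
elim: m => [|m IH]; first by rewrite /pochhammer !big_ord0 muln0 addn0 !mulr1.
rewrite (_ : (n + 2 * m.+1 = (n + 2 * m).+2)%N); last by lia.
rewrite !pochhammerS -IH exprS -(natr1 (n + 2 * m)) natrD natrM.
by field.
Qed.

Lemma pochhammer_fact n m :
  pochhammer (n%:R + 2) m * (n.+1)`!%:R = (n + m + 1)`!%:R :> R.
Proof.
elim: m => [|m IH]; first by rewrite /pochhammer big_ord0 addn0 addn1 mul1r.
rewrite (_ : (n + m.+1 + 1 = (n + m + 1).+1)%N); last by lia.
rewrite pochhammerS mulrAC IH factS natrM mulrC; congr (_ * _).
by rewrite -(natr1 (n + m + 1)) !natrD; ring.
Qed.

End Coefficients.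

(** * Dominated convergence for real-valued integrals *)

Section DominatedConvergence.
Context d (T : measurableType d) (R : realType) (mu : {measure set T -> \bar R}).
Variables (D : set T) (mD : measurable D).

Lemma Rintegral_dominated_cvg (f : nat -> T -> R) (g G : T -> R) :
  (forall n, measurable_fun D (f n)) ->
  (forall x, D x -> f n x @[n --> \oo] --> g x) ->
  mu.-integrable D (EFin \o G) ->
  (forall n x, D x -> `|f n x| <= G x) ->
  [/\ forall n, mu.-integrable D (EFin \o f n), mu.-integrable D (EFin \o g) &
      \int[mu]_(x in D) f n x @[n --> \oo] --> \int[mu]_(x in D) g x].
Proof.
move=> mf fg iG fG.
have mg : measurable_fun D g by exact: (measurable_realfun.measurable_fun_cvg mf fg).
have inf n : mu.-integrable D (EFin \o f n).
  apply: (le_integrable mD _ _ iG); first exact/measurable_EFinP.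
  move=> x Dx /=; rewrite lee_fin.
  exact: le_trans (fG n x Dx) (ler_norm _).
have [|||||ig _ cI] := @dominated_convergence _ _ _ mu D mD (fun n => EFin \o f n)
  (EFin \o g) (EFin \o G).
- by move=> n; exact/measurable_EFinP.
- exact/measurable_EFinP.
- by apply: aeW => x Dx; apply: cvg_EFin; [exact: nearW|exact: fg].
- exact: iG.
- by apply: aeW => x n Dx; exact: fG.
split => //.
have fI : (\int[mu]_(x in D) (EFin \o g) x)%E \is a fin_num by exact: integrable_fin_num.
rewrite /Rintegral.
by apply: fine_cvg; rewrite fineK.
Qed.

Lemma integrable_scale (k : R) (f : T -> R) : mu.-integrable D (EFin \o f) ->
  mu.-integrable D (EFin \o (fun x => k * f x)).
Proof. by move=> /(integrableZl mD k); apply: eq_integrable => // x _ /=; rewrite EFinM. Qed.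

End DominatedConvergence.

(** * Integrability and term-by-term integration *)

Section HalfLine.
Context {R : realType}.
Implicit Types (n M N k : nat) (x : R).
Local Notation mu := (@lebesgue_measure R).
Local Notation D := (`]0%R, +oo[%classic : set R).

Let mD : measurable (D : set (measurableTypeR R)). Proof. exact: measurable_itv. Qed.
Let Dgt0 x : D x -> 0 < x. Proof. by rewrite /= in_itv/= andbT. Qed.

(** The Cayley map sends the half line onto [(-1, 1)] and [x -> 1/x] to the
change of sign. *)
Let cayley x : R := (x - 1) / (x + 1).

Lemma integrable_expRN : mu.-integrable D (EFin \o (fun x => expR (- x))).
Proof.
have h : mu.-integrable D (EFin \o exponential_pdf 1).
  by apply: (integrableS measurableT) => //; exact: integrable_exponential_pdf.
apply: eq_integrable h => // x; rewrite inE => /Dgt0 /ltW x0 /=.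
by rewrite exponential_pdfE// mul1r mulN1r.
Qed.

Lemma cayley_norm_lt1 x : 0 < x -> `|cayley x| < 1.
Proof.
move=> x0; have x1 : 0 < x + 1 by rewrite addr_gt0.
rewrite /cayley ltr_norml ltr_pdivrMr// ltr_pdivlMr//; apply/andP; split; lra.
Qed.

Lemma cayley_sqr01 x : 0 < x -> 0 <= cayley x ^+ 2 < 1.
Proof. by move=> x0; rewrite sqr_ge0/= -real_normK ?num_real// exprn_ilt1 ?cayley_norm_lt1. Qed.

Lemma onem_cayley_sqr x : 0 < x -> (1 - cayley x ^+ 2)^-1 = (x + 1) ^+ 2 / (4 * x).
Proof.
move=> x0; have x1 : 0 < x + 1 by rewrite addr_gt0.
have -> : 1 - cayley x ^+ 2 = 4 * x / (x + 1) ^+ 2.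
  by rewrite /cayley; field; exact: lt0r_neq0.
by rewrite invf_div.
Qed.

Lemma weight_ge1 x : 0 < x -> 1 <= (x + 1) ^+ 2 / (4 * x).
Proof. by move=> x0; rewrite ler_pdivlMr ?mulr_gt0//; have := sqr_ge0 (x - 1); lra. Qed.

Lemma c_integrand_le n x : 0 < x -> `|c_integrand n x| <= omega x / (x + 1).
Proof.
move=> x0; have x1 : 0 < x + 1 by rewrite addr_gt0.
have w0 := omega_gt0 x0.
have p0 : 0 < (x + 1) `^ (3 / 2) by rewrite powR_gt0.
rewrite /c_integrand normrM ger0_norm; last by rewrite divr_ge0 ?ltW.
rewrite -[leRHS]mulr1; apply: ler_pM => //; first by rewrite divr_ge0 ?ltW.
  rewrite ler_wpM2l ?(ltW w0)// lef_pV2 ?posrE//.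
  by rewrite -[leLHS]powRr1 ?(ltW x1)// ler_powR//; lra.
by rewrite normrX exprn_ile1//; exact/ltW/cayley_norm_lt1.
Qed.

(** The factor [(x+1)^2 / (4x)] is the value of [1 / (1 - z)] at the squared
Cayley variable.  For [x >= 1] it is harmless; for [x < 1] the functional
equation gives [omega x] the decay [y exp (-y)] with [y = 1/x], which beats
the pole. *)
Lemma omega_weight_le x : 0 < x ->
  omega x / (x + 1) * ((x + 1) ^+ 2 / (4 * x)) <= @omega_bound R * expR 1 * expR (- x).
Proof.
move=> x0; have x1 : 0 < x + 1 by rewrite addr_gt0.
have xn0 := lt0r_neq0 x0.
have B0 := @omega_bound_ge0 R; have w0 := omega_gt0 x0.
have -> : omega x / (x + 1) * ((x + 1) ^+ 2 / (4 * x)) = omega x * ((x + 1) / (4 * x)).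
  by field; rewrite xn0 lt0r_neq0.
have [h1|h1] := leP 1 x.
  have a : (x + 1) / (4 * x) <= 1 by rewrite ler_pdivrMr ?mulr_gt0//; lra.
  have e1 : (1 : R) <= expR 1 by rewrite -[leLHS]expR0 ler_expR.
  apply: le_trans (_ : omega x * 1 <= _); first by rewrite ler_wpM2l// ltW.
  rewrite mulr1; apply: le_trans (omega_le h1) _.
  by rewrite ler_wpM2r ?expR_ge0// ler_peMr.
set y := x^-1; have y0 : 0 < y by rewrite invr_gt0.
have y1 : 1 <= y by rewrite invf_ge1// ltW.
have xE : x = y^-1 by rewrite invrK.
have a : (x + 1) / (4 * x) <= y / 2.
  by rewrite ler_pdivrMr ?mulr_gt0// (_ : y / 2 * (4 * x) = 2); [lra|rewrite /y; field].
have s : Num.sqrt y <= y.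
  by rewrite -[leRHS]ger0_norm ?(ltW y0)// -sqrtr_sqr ler_sqrt ?sqr_ge0// expr2 ler_peMl// ltW.
have wy : omega x <= y * (@omega_bound R * expR (- y)).
  rewrite xE omega_inv//; apply: ler_pM => //.
    by rewrite ltW// omega_gt0.
  exact: omega_le.
have E0 := expR_gt0 (- y).
apply: le_trans (ler_pM (ltW w0) _ wy a) _.
  by rewrite divr_ge0 ?mulr_ge0// ltW.
have ye := expR_ge_sqr (ltW y0).
have EE := expRxMexpNx_1 y.
have y2e : y ^+ 2 / 2 * expR (- y) <= 1.
  apply: le_trans (_ : expR y * expR (- y) <= 1); last by rewrite EE.
  by rewrite ler_wpM2r ?(ltW E0)//; lra.
have -> : y * (@omega_bound R * expR (- y)) * (y / 2) = @omega_bound R * (y ^+ 2 / 2 * expR (- y)).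
  by field.
rewrite -[leRHS]mulrA ler_wpM2l// (le_trans y2e)// -expRD -[leLHS]expR0 ler_expR subr_ge0 ltW//.
Qed.

Lemma continuous_cayley x : 0 < x -> {for x, continuous cayley}.
Proof.
move=> x0; apply: cvgM; first by apply: cvgB; [exact: cvg_id|exact: cvg_cst].
apply: cvgV; first by rewrite lt0r_neq0// addr_gt0.
by apply: cvgD; [exact: cvg_id|exact: cvg_cst].
Qed.

Lemma continuous_c_integrand n x : 0 < x -> {for x, continuous (@c_integrand R n)}.
Proof.
move=> x0; have x1 : 0 < x + 1 by rewrite addr_gt0.
have cden : {for x, continuous (fun y : R => (y + 1) `^ (3 / 2))}.
  apply: (@continuous_comp _ _ _ (fun y : R => y + 1) (fun y : R => y `^ (3 / 2))).
    by apply: cvgD; [exact: cvg_id|exact: cvg_cst].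
  apply/differentiable_continuous/derivable1_diffP.
  by apply: ex_derive; exact: is_derive1_powR.
have cnum : {for x, continuous (fun y : R => cayley y ^+ n)}.
  apply: (@continuous_comp _ _ _ cayley (fun y : R => y ^+ n)).
    exact: continuous_cayley.
  exact: exprn_continuous.
apply: cvgM cnum; apply: cvgM; first exact: omega_continuous.
by apply: cvgV cden; rewrite lt0r_neq0// powR_gt0.
Qed.

Lemma measurable_c_integrand n : measurable_fun D (@c_integrand R n).
Proof.
apply: open_continuous_measurable_fun; first exact: interval_open.
by move=> x; rewrite inE => /Dgt0; exact: continuous_c_integrand.
Qed.

(** Partial sums of the hypergeometric series inside the integrand of [d_n];
each power of [z] raises the exponent of the Cayley factor by [2]. *)
Definition d_partial (t : nat -> R) n M x : R := \sum_(0 <= k < M) t k * c_integrand (n + 2 * k) x.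

Lemma d_partialE t n M x : d_partial t n M x =
  c_integrand n x * \sum_(0 <= k < M) t k * (cayley x ^+ 2) ^+ k.
Proof.
rewrite big_distrr/=; apply: eq_bigr => k _.
by rewrite /c_integrand -/(cayley x) exprD exprM; ring.
Qed.

Lemma measurable_d_partial t n M : measurable_fun D (d_partial t n M).
Proof.
apply: measurable_sum => k; apply: measurable_funM; first exact: measurable_cst.
exact: measurable_c_integrand.
Qed.

Lemma integrable_c_integrand n : mu.-integrable D (EFin \o @c_integrand R n).
Proof.
have iE : mu.-integrable D (EFin \o (fun x => @omega_bound R * expR 1 * expR (- x))).
  by apply: integrable_scale => //; exact: integrable_expRN.
apply: le_integrable iE => //.
  by apply/measurable_EFinP; exact: measurable_c_integrand.
move=> x /Dgt0 x0 /=; rewrite lee_fin.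
apply: le_trans (c_integrand_le _ x0) _.
apply: le_trans (ler_norm _); apply: le_trans (omega_weight_le x0).
rewrite ler_peMr//; first by rewrite divr_ge0 ?ltW ?omega_gt0// addr_gt0.
exact: weight_ge1.
Qed.

Lemma Rintegral_d_partial t n M :
  \int[mu]_(x in D) d_partial t n M x =
  \sum_(0 <= k < M) t k * \int[mu]_(x in D) c_integrand (n + 2 * k) x.
Proof.
have I k : mu.-integrable D (EFin \o (fun x => t k * c_integrand (n + 2 * k) x)).
  by apply: integrable_scale => //; exact: integrable_c_integrand.
suff : mu.-integrable D (EFin \o d_partial t n M) /\ \int[mu]_(x in D) d_partial t n M x =
  \sum_(0 <= k < M) t k * \int[mu]_(x in D) c_integrand (n + 2 * k) x by case.
elim: M => [|M [IH1 IH2]].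
  have e : d_partial t n 0 = cst 0 by apply/funext => x; rewrite /d_partial big_geq.
  rewrite e; split; first exact: integrable0.
  by rewrite big_geq// Rintegral_cst// mul0r.
have e : d_partial t n M.+1 = fun x => d_partial t n M x + t M * c_integrand (n + 2 * M) x.
  by apply/funext => x; rewrite /d_partial big_nat_recr.
rewrite e; split.
  by have := integrableD mD IH1 (I M); apply: eq_integrable => // x _ /=; rewrite EFinD.
rewrite RintegralD// IH2 RintegralZl//; last exact: integrable_c_integrand.
by rewrite big_nat_recr.
Qed.

Let a n : R := n%:R / 2 + 3 / 4.
Let b n : R := n%:R / 2 + 5 / 4.
Let c n : R := n%:R + 2.
Let t n := hyp_coef (a n) (b n) (c n).

Let a0 n : 0 < a n. Proof. by rewrite ltr_wpDl. Qed.
Let b0 n : 0 < b n. Proof. by rewrite ltr_wpDl. Qed.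
Let cg0 n : 0 < c n. Proof. by rewrite ltr_wpDl. Qed.
Let abc n : a n + b n <= c n. Proof. rewrite /a /b /c; lra. Qed.

(** The partial sums are all dominated by [H omega / (x+1) * (x+1)^2 / (4x)],
with [H] a bound for the hypergeometric coefficients. *)
Lemma d_series n :
  mu.-integrable D (EFin \o @d_integrand R n) /\
  \sum_(0 <= k < M) t n k * \int[mu]_(x in D) c_integrand (n + 2 * k) x @[M --> \oo]
    --> \int[mu]_(x in D) d_integrand n x.
Proof.
have [H tH] := hyp_coef_bounded (a0 n) (b0 n) (cg0 n) (abc n).
have H1 := hyp_bound_ge1 tH.
have iE : mu.-integrable D (EFin \o (fun x => H * (@omega_bound R * expR 1) * expR (- x))).
  by apply: integrable_scale => //; exact: integrable_expRN.
have [] := @Rintegral_dominated_cvg _ _ R mu D mD (d_partial (t n) n) (@d_integrand R n) _ _ _ iE.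
- exact: measurable_d_partial.
- move=> x /Dgt0 x0.
  under eq_fun do rewrite d_partialE.
  apply: cvgM; first exact: cvg_cst.
  by apply: cvg_hyp2F1 => //; exact: cayley_sqr01.
- move=> M x /Dgt0 x0; rewrite d_partialE normrM.
  have z01 := cayley_sqr01 x0.
  have h : `|\sum_(0 <= k < M) t n k * (cayley x ^+ 2) ^+ k| <= H * ((x + 1) ^+ 2 / (4 * x)).
    rewrite ger0_norm; first by rewrite -onem_cayley_sqr// hyp_partial_le.
    by apply: sumr_ge0 => k _; apply: mulr_ge0; [exact/ltW/(hyp_coef_gt0 _ (a0 n) (b0 n) (cg0 n))|exact/exprn_ge0/sqr_ge0].
  apply: le_trans (ler_pM _ _ (c_integrand_le _ x0) h) _ => //.
  rewrite mulrCA -[leRHS]mulrA ler_wpM2l//; first exact: le_trans H1.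
  exact: omega_weight_le.
move=> _ i cI; split => //.
by under eq_fun do rewrite -Rintegral_d_partial.
Qed.

End HalfLine.

(** * Vanishing of the odd coefficients *)

Section OddMoments.
Context {R : realType}.
Implicit Types (n N : nat) (x y : R).
Local Notation mu := (@lebesgue_measure R).
Local Notation D := (`]0%R, +oo[%classic : set R).

Let mD : measurable (D : set (measurableTypeR R)). Proof. exact: measurable_itv. Qed.

Lemma powR32 y : 0 < y -> y `^ (3 / 2) = y * Num.sqrt y.
Proof.
move=> y0; have -> : 3 / 2 = 1 + 2^-1 :> R by field.
by rewrite powRD ?(lt0r_neq0 y0) ?implybT// powRr1 ?ltW// powR12_sqrt ?ltW.
Qed.

(** The measure [dx] picks up [1/x^2], the denominator a factor
[x^(3/2)] and [omega] a factor [x^(1/2)]; these balance and leave the sign of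
the Cayley factor. *)
Lemma c_integrand_inv n x : 0 < x ->
  c_integrand n x^-1 * (x ^+ 2)^-1 = (-1) ^+ n * c_integrand n x.
Proof.
move=> x0; have x1 : 0 < x + 1 by rewrite addr_gt0.
have xv : x^-1 + 1 = x^-1 * (x + 1) by field; exact: lt0r_neq0.
rewrite /c_integrand omega_inv// [in LHS]powR32 ?addr_gt0 ?invr_gt0// [in RHS]powR32//.
have -> : (x^-1 - 1) / (x^-1 + 1) = - ((x - 1) / (x + 1)).
  by field; rewrite !lt0r_neq0// addr_gt0.
rewrite xv sqrtrM ?invr_ge0 ?ltW// sqrtrV ?ltW// [(- ((x - 1) / (x + 1))) ^+ n]exprNn.
have s0 : Num.sqrt x != 0 by rewrite lt0r_neq0// sqrtr_gt0.
have s1 : Num.sqrt (x + 1) != 0 by rewrite lt0r_neq0// sqrtr_gt0.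
have ss : x = Num.sqrt x ^+ 2 by rewrite sqr_sqrtr// ltW.
move: ((-1) ^+ n) (((x - 1) / (x + 1)) ^+ n) (omega x) (Num.sqrt (x + 1)) s1 => e y w r s1.
have xn1 : x + 1 != 0 by rewrite lt0r_neq0.
move: (Num.sqrt x) s0 ss xn1 => s s0 -> xn1.
by field; rewrite s0 s1 xn1.
Qed.

Lemma derive1_inv x : 0 < x -> (fun y : R => y^-1)^`()%classic x = - (x ^+ 2)^-1.
Proof.
move=> x0; rewrite derive1E.
have := @is_deriveV R id x 1 1 (lt0r_neq0 x0) (is_derive_id x 1).
by move=> /(@derive_val _ _ _ _ _ _ _) ->; rewrite /GRing.scale/= mulr1.
Qed.

Lemma continuous_derive1_inv x : 0 < x ->
  {for x, continuous (fun y : R => y^-1)^`()%classic}.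
Proof.
move=> x0; rewrite /prop_for /continuous_at derive1_inv//.
have c : - (y ^+ 2)^-1 @[y --> x] --> - (x ^+ 2)^-1.
  apply: cvgN; apply: cvgV; first by rewrite expf_neq0 ?lt0r_neq0.
  exact: exprn_continuous.
refine (cvg_trans (near_eq_cvg _) c); near=> y.
rewrite derive1_inv//; near: y; apply: (cvgr_gt x) => //; exact: cvg_id.
Unshelve. all: end_near. Qed.

(** On an interval invariant under [x -> 1/x] the substitution shows that the
integral equals its opposite. *)
Lemma odd_moment_itv n N :
  \int[mu]_(x in `[N.+1%:R^-1, N.+1%:R]) c_integrand (2 * n + 1) x = 0.
Proof.
set m := (2 * n + 1)%N; set b : R := N.+1%:R.
have b0 : 0 < b by rewrite ltr0n.
have b1 : 1 <= b by rewrite ler1n.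
have bv0 : 0 < b^-1 by rewrite invr_gt0.
have ab : b^-1 <= b by apply: le_trans (b1); rewrite invf_le1.
have pos x : x \in `[b^-1, b] -> 0 < x.
  by rewrite in_itv/= => /andP[h _]; exact: lt_le_trans h.
have poso x : x \in `]b^-1, b[ -> 0 < x.
  by rewrite in_itv/= => /andP[h _]; exact: lt_trans h.
have cinv x : 0 < x -> {for x, continuous (fun y : R => y^-1)}.
  by move=> x0; apply: cvgV; [exact: lt0r_neq0|exact: cvg_id].
have := @integration_by_substitution_decreasing R (fun y => y^-1) (@c_integrand R m) b^-1 b ab.
rewrite invrK => H.
have sgn : (-1) ^+ m = -1 :> R by rewrite /m exprD exprM sqrrN !expr1n mul1r expr1.
pose J : set R := `[b^-1, b]%classic.
have {H} E : (\int[mu]_(x in J) (c_integrand m x)%:E)%E =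
  (\int[mu]_(x in J) (- c_integrand m x)%:E)%E.
  rewrite H.
  - apply: eq_integral => x; rewrite inE/= => /pos x0; congr EFin.
    change (c_integrand m x^-1 * - (fun y : R => y^-1)^`()%classic x = - c_integrand m x).
    by rewrite derive1_inv// opprK c_integrand_inv// sgn mulN1r.
  - move=> x y /pos x0 /pos y0 xy; by rewrite ltf_pV2.
  - by move=> x /poso x0; exact: continuous_derive1_inv.
  - apply/cvg_ex; exists ((fun y : R => y^-1)^`()%classic b^-1).
    exact/cvg_at_right_filter/continuous_derive1_inv.
  - apply/cvg_ex; exists ((fun y : R => y^-1)^`()%classic b).
    exact/cvg_at_left_filter/continuous_derive1_inv.
  - split.
    + by move=> x /poso x0; apply: derivableV; rewrite ?lt0r_neq0.
    + exact/cvg_at_right_filter/cinv.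
    + exact/cvg_at_left_filter/cinv.
  - apply: continuous_in_subspaceT => x; rewrite inE/= => /pos x0.
    exact: continuous_c_integrand.
have mI : measurable (`[b^-1, b]%classic : set (measurableTypeR R)) by exact: measurable_itv.
have i : mu.-integrable `[b^-1, b] (EFin \o @c_integrand R m).
  apply: integrableS (integrable_c_integrand m) => //.
  by move=> x /pos x0; rewrite /= in_itv/= x0.
have {E} : \int[mu]_(x in `[b^-1, b]) c_integrand m x = \int[mu]_(x in `[b^-1, b]) (-1 * c_integrand m x).
  rewrite /Rintegral -/J E; congr fine; apply: eq_integral => x _.
  by rewrite mulN1r.
rewrite RintegralZl//; lra.
Qed.

(** The invariant compact intervals [[1/(N+1), N+1]] exhaust the half line. *)
Lemma odd_moment n : \int[mu]_(x in D) c_integrand (2 * n + 1) x = 0.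
Proof.
set m := (2 * n + 1)%N.
pose I N : set R := `[N.+1%:R^-1, N.+1%:R]%classic.
have [] := @Rintegral_dominated_cvg _ _ R mu D mD (fun N => (@c_integrand R m) \_ (I N)) (@c_integrand R m)
  (fun x => `|c_integrand m x|).
- move=> N; apply/measurable_restrict => //; first exact: measurable_itv.
  by apply: measurable_funS (measurable_c_integrand m) => //; exact: subIsetl.
- move=> x /=; rewrite in_itv/= andbT => x0.
  apply: cvg_near_cst; near=> N.
  rewrite patchE ifT// inE /I /= in_itv/=; apply/andP; split.
    rewrite invf_ple ?posrE ?ltr0n// -natr1 ler_wpDr//; near: N; exact: nbhs_infty_ger.
  by rewrite -natr1 ler_wpDr//; near: N; exact: nbhs_infty_ger.
- exact: integrable_norm (integrable_c_integrand m).
- by move=> N x Dx; rewrite patchE; case: ifP => // _; rewrite normr0.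
move=> _ _ c; rewrite -(cvg_lim _ c)//.
apply: lim_near_cst => //; near=> N.
rewrite -Rintegral_mkcondr (_ : D `&` I N = I N); first exact: odd_moment_itv.
apply/setIidr => x; rewrite /I /= !in_itv/= andbT => /andP[h _].
by apply: lt_le_trans h; rewrite invr_gt0.
Unshelve. all: end_near. Qed.

End OddMoments.

(** * Positivity and the expansion of the coefficients *)

Section Conclusion.
Context {R : realType}.
Implicit Types (n m k M : nat) (x : R).
Local Notation mu := (@lebesgue_measure R).
Local Notation D := (`]0%R, +oo[%classic : set R).

Let mD : measurable (D : set (measurableTypeR R)). Proof. exact: measurable_itv. Qed.

Let t n : nat -> R := hyp_coef (n%:R / 2 + 3 / 4) (n%:R / 2 + 5 / 4) (n%:R + 2).
Let I n : R := \int[mu]_(x in D) c_integrand n x.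
Let K n : R := pochhammer (3 / 2) n / (2 `^ (n%:R - 3 / 2) * n`!%:R).

Lemma c_integrand_even_ge0 n x : 0 < x -> 0 <= c_integrand (2 * n) x.
Proof.
move=> x0; rewrite /c_integrand exprM; apply: mulr_ge0; last exact/exprn_ge0/sqr_ge0.
by rewrite divr_ge0 ?powR_ge0// ltW// omega_gt0.
Qed.

(** The hypergeometric factor is at least its constant term [1]. *)
Lemma c_integrand_le_d_integrand n x : 0 < x ->
  c_integrand (2 * n) x <= d_integrand (2 * n) x.
Proof.
move=> x0; rewrite -[leLHS]mulr1 /d_integrand ler_wpM2l//; first exact: c_integrand_even_ge0.
have p k : 0 < (2 * n)%:R / 2 + k.+1%:R / 4 :> R by rewrite ltr_wpDl ?divr_gt0.
have p2 : 0 < (2 * n)%:R + 2 :> R by rewrite ltr_wpDl.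
have pc : (2 * n)%:R / 2 + 3 / 4 + ((2 * n)%:R / 2 + 5 / 4) <= (2 * n)%:R + 2 :> R by lra.
have [H tH] := hyp_coef_bounded (p 2) (p 4) p2 pc.
exact: (hyp2F1_ge1 (p 2) (p 4) p2 tH (cayley_sqr01 x0)).
Qed.

Lemma c_integrand_even_gt0 n x : 1 < x -> 0 < c_integrand (2 * n) x.
Proof.
move=> x1; have x0 : 0 < x by apply: lt_trans x1.
have x10 : 0 < x + 1 by rewrite addr_gt0.
rewrite /c_integrand mulr_gt0 ?divr_gt0 ?omega_gt0 ?powR_gt0//.
by rewrite exprn_gt0// divr_gt0// subr_gt0.
Qed.

(** Otherwise [f] would vanish almost everywhere, whereas it is positive on
[]1, 2[], of measure [1]. *)
Lemma Rintegral_gt0 (f : R -> R) : mu.-integrable D (EFin \o f) ->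
  (forall x, 0 < x -> 0 <= f x) -> (forall x, 1 < x -> 0 < f x) ->
  0 < \int[mu]_(x in D) f x.
Proof.
move=> fi f0 f1.
have Dgt0 x : D x -> 0 < x by rewrite /= in_itv/= andbT.
rewrite lt0r; apply/andP; split; last by apply: Rintegral_ge0 => x /Dgt0; exact: f0.
apply/eqP => I0.
have mf : measurable_fun D (EFin \o f) by case/integrableP: fi.
have Z : (\int[mu]_(x in D) `|(EFin \o f) x|)%E = 0%E.
  have -> : (\int[mu]_(x in D) `|(EFin \o f) x|)%E = (\int[mu]_(x in D) (EFin \o f) x)%E.
    by apply: eq_integral => x; rewrite inE => /Dgt0 x0 /=; rewrite ger0_norm// f0.
  by rewrite -[LHS](fineK (integrable_fin_num mD fi)); congr EFin; exact: I0.
have [N [mN N0 sub]] := (ae_eq_integral_abs mu mD mf).1 Z.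
have h : (`]1%R, 2%R[%classic : set R) `<=` N.
  move=> x /=; rewrite in_itv/= => /andP[x1 _]; apply: sub => /= /(_ _).
  have Dx : D x by rewrite /= in_itv/= andbT (lt_trans _ x1).
  by move=> /(_ Dx) /eqP; rewrite eqe gt_eqF// f1.
have : (mu (`]1%R, 2%R[%classic : set R) <= mu N)%E.
  by apply: le_measure => //; rewrite inE//; exact: measurable_itv.
rewrite N0 lebesgue_measure_itv/= lte_fin ifT; last by lra.
by rewrite -EFinB lee_fin; lra.
Qed.

Lemma K_gt0 n : 0 < K n.
Proof.
by rewrite /K divr_gt0 ?pochhammer_gt0// mulr_gt0 ?powR_gt0// ltr0n fact_gt0.
Qed.

Lemma powR2_32 n : 2 `^ (n%:R - 3 / 2) = 2 ^+ n / (2 * Num.sqrt 2) :> R.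
Proof. by rewrite powRB ?(@pnatr_eq0 R 2) ?implybT// powR_mulrn// powR32. Qed.

(** [pochhammer_duplication] and [pochhammer_fact] convert the coefficients of
2F1 into those of the expansion; the powers of [2] come from the two
normalizations [2 sqrt 2] and [2^(n - 3/2)]. *)
Lemma coefficient_identity n m :
  pochhammer (3 / 2) (n + 2 * m) / (4 ^+ m * m`!%:R * (n + m + 1)`!%:R) * c_coef R (n + 2 * m)
  = 2 ^+ n / n.+1%:R * K n * (t n m * I (n + 2 * m)).
Proof.
rewrite /c_coef -/(I _) -pochhammer_duplication -pochhammer_fact /K powR2_32 /t /hyp_coef factS natrM.
have s2 : Num.sqrt 2 != 0 :> R by rewrite lt0r_neq0// sqrtr_gt0.
have f1 : n`!%:R != 0 :> R by rewrite pnatr_eq0 -lt0n fact_gt0.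
have f2 : m`!%:R != 0 :> R by rewrite pnatr_eq0 -lt0n fact_gt0.
have f3 : n.+1%:R != 0 :> R by rewrite pnatr_eq0.
have f4 : 4 ^+ m != 0 :> R by rewrite expf_neq0.
have f5 : 2 ^+ n != 0 :> R by rewrite expf_neq0.
have f6 : pochhammer (n%:R + 2) m != 0 :> R by rewrite lt0r_neq0// pochhammer_gt0// ltr_wpDl.
move: (I _) (Num.sqrt 2) (n`!%:R) (m`!%:R) (n.+1%:R) (4 ^+ m) (2 ^+ n) (pochhammer (n%:R + 2) m)
  (pochhammer (n%:R / 2 + 3 / 4) m) (pochhammer (n%:R / 2 + 5 / 4) m) s2 f1 f2 f3 f4 f5 f6.
move=> i s u v w y z r p q s2 f1 f2 f3 f4 f5 f6; field.
by rewrite s2 f1 f2 f3 f4 f5 f6.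
Qed.

Lemma d_coef_series n : let s := fun M : nat =>
  \sum_(0 <= m < M) pochhammer (3 / 2) (n + 2 * m)
     / (4 ^+ m * m`!%:R * (n + m + 1)`!%:R) * c_coef R (n + 2 * m) in
  s M @[M --> \oo] --> 2 ^+ n / n.+1%:R * d_coef R n.
Proof.
move=> s; have [_ c] := @d_series R n.
rewrite (_ : s = fun M => 2 ^+ n / n.+1%:R * K n * \sum_(0 <= k < M) t n k * I (n + 2 * k)).
  rewrite (_ : 2 ^+ n / n.+1%:R * d_coef R n =
    2 ^+ n / n.+1%:R * K n * \int[mu]_(x in D) d_integrand n x); last by rewrite mulrA.
  exact: (cvgM (cvg_cst _) c).
apply/funext => M; rewrite big_distrr/=; apply: eq_bigr => m _.
exact: coefficient_identity.
Qed.

End Conclusion.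

Theorem proposition5p1 (R : realType) :
  [/\ forall n : nat,
        (@lebesgue_measure R).-integrable `]0, +oo[
          (fun x : R => (d_integrand n x)%:E),
      forall n : nat, d_coef R (2 * n + 1) = 0,
      forall n : nat, 0 < d_coef R (2 * n)
    & forall n : nat,
        let s := fun M : nat =>
          \sum_(0 <= m < M)
            pochhammer (3 / 2) (n + 2 * m)
              / (4 ^+ m * m`!%:R * (n + m + 1)`!%:R)
              * c_coef R (n + 2 * m) in
        cvgn s /\ d_coef R n = (n.+1)%:R / 2 ^+ n * limn s].
Proof.
have alt n : d_coef R n = n.+1%:R / 2 ^+ n * (2 ^+ n / n.+1%:R * d_coef R n).
  by field; rewrite expf_neq0// addrC natr1 pnatr_eq0.
split.
- by move=> n; have [] := @d_series R n.
- move=> n; have := @d_coef_series R (2 * n + 1).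
  rewrite (_ : (fun M : nat => _) = fun=> 0) => [/(cvg_lim (@Rhausdorff R))|].
    by rewrite lim_cst// => h; rewrite alt -h mulr0.
  apply/funext => M; rewrite big1// => m _.
  by rewrite (_ : (2 * n + 1 + 2 * m = 2 * (n + m) + 1)%N) ?/c_coef ?odd_moment ?mulr0//; lia.
- move=> n; rewrite /d_coef mulr_gt0 ?K_gt0//.
  have [i _] := @d_series R (2 * n).
  apply: Rintegral_gt0 i _ _ => x x0.
    by apply: le_trans (c_integrand_le_d_integrand n x0); exact: c_integrand_even_ge0.
  apply: lt_le_trans (c_integrand_even_gt0 n x0) _.
  by apply: c_integrand_le_d_integrand; exact: lt_trans x0.
- move=> n s; have c := @d_coef_series R n.
  split; first exact: cvgP c.
  by rewrite (cvg_lim (@Rhausdorff R) c).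
Qed.
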